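(* Let $n \ge 2$, and let $\gamma \colon [a,b] \to \mathbb{R}^n$ ($a<b$) be an analytic curve whose image $\gamma([a,b])$ is not contained in any (affine) hyperplane of $\mathbb{R}^n$. Then $\gamma([a,b])$ contains a non-trivial self-affine set if and only if there exist real numbers $c<d$ and an invertible affine map $f \colon \mathbb{R}^n \to \mathbb{R}^n$ such that $\gamma([a,b]) = f(\eta([c,d]))$, where $\eta \colon [c,d] \to \mathbb{R}^n$ is given by $\eta(t) = (t,t^2,\ldots,t^n)$.
   Context: A map $f \colon \mathbb{R}^n \to \mathbb{R}^n$ is affine if $f(x) = Tx + v$ for all $x\in\mathbb{R}^n$, where $T$ is an $n \times n$ real matrix (the linear part) and $v \in \mathbb{R}^n$; it is invertible iff $T$ is non-singular. A map $f \colon \mathbb{R}^n \to \mathbb{R}^n$ is strictly contractive if $|f(x)-f(y)| < |x-y|$ for all distinct $x,y \in \mathbb{R}^n$ (Euclidean norm); an affine map is strictly contractive iff its linear part has operator norm $\|T\|<1$. An affine iterated function system (IFS) is a finite collection $\{f_i\}_{i=1}^\ell$ of strictly contractive invertible affine maps $f_i \colon \mathbb{R}^n \to \mathbb{R}^n$. A non-empty compact set $E \subset \mathbb{R}^n$ is self-affine if $E = \bigcup_{i=1}^\ell f_i(E)$ for some affine IFS $\{f_i\}_{i=1}^\ell$. A self-affine set is non-trivial if it is not a singleton. A curve is a non-constant continuous function $\gamma \colon [a,b] \to \mathbb{R}^n$ with $a<b$. A curve $\gamma(t) = (x_1(t),\ldots,x_n(t))$ is analytic if each $x_i \colon [a,b]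 \to \mathbb{R}$ is continuous on $[a,b]$ and real analytic on $(a,b)$. *)

(* Defs.v *)
From HB Require Import structures.
From mathcomp Require Import all_boot all_order all_algebra.
From mathcomp Require Import all_classical all_reals all_analysis.

Set Implicit Arguments.
Unset Strict Implicit.
Unset Printing Implicit Defensive.

Import Order.TTheory GRing.Theory Num.Theory.
Import numFieldNormedType.Exports.

Local Open Scope classical_set_scope.
Local Open Scope ring_scope.

(* Points of R^n are column vectors, with the library's product topology.  The
   library's norm `|x| on matrices is the sup norm, hence the separate
   Euclidean norm. *)
Definition enorm (R : realType) (n : nat) (x : 'cV[R]_n) : R :=
  Num.sqrt (\sum_(i < n) x i 0 ^+ 2).

Definition affine_map (R : realType) (n : nat) (f : 'cV[R]_n -> 'cV[R]_n) :
    Prop :=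
  exists (T : 'M[R]_n) (v : 'cV[R]_n), forall x, f x = T *m x + v.

Definition invertible_affine_map (R : realType) (n : nat)
    (f : 'cV[R]_n -> 'cV[R]_n) : Prop :=
  affine_map f /\ bijective f.

Definition strictly_contractive (R : realType) (n : nat)
    (f : 'cV[R]_n -> 'cV[R]_n) : Prop :=
  forall x y : 'cV[R]_n, x != y -> enorm (f x - f y) < enorm (x - y).

Definition affine_IFS (R : realType) (n l : nat)
    (f : 'I_l -> 'cV[R]_n -> 'cV[R]_n) : Prop :=
  forall i, strictly_contractive (f i) /\ invertible_affine_map (f i).

(* The case l = 0 is harmless: the union is then empty, and E is not. *)
Definition self_affine (R : realType) (n : nat) (E : set 'cV[R]_n) : Prop :=
  [/\ E !=set0, compact E &
      exists (l : nat) (f : 'I_l -> 'cV[R]_n -> 'cV[R]_n),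
        affine_IFS f /\ E = \bigcup_(i in [set: 'I_l]) (f i @` E)].

Definition nontrivial_self_affine (R : realType) (n : nat)
    (E : set 'cV[R]_n) : Prop :=
  self_affine E /\ ~ (exists x, E = [set x]).

Definition hyperplane (R : realType) (n : nat) (H : set 'cV[R]_n) : Prop :=
  exists (u : 'cV[R]_n) (c : R),
    u != 0 /\ H = [set x | \sum_(i < n) u i 0 * x i 0 = c].

Definition real_analytic_at (R : realType) (g : R -> R) (t0 : R) : Prop :=
  exists c : R^nat, \forall t \near t0, pseries c (t - t0) @ \oo --> g t.

(* A function on [a, b] is a total function on R of which only the values on
   [a, b] matter. *)
Definition is_curve (R : realType) (n : nat) (a b : R) (gamma : R -> 'cV[R]_n) :
    Prop :=
  [/\ a < b, {within `[a, b], continuous gamma} &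
      ~ (exists p, forall t, t \in `[a, b] -> gamma t = p)].

Definition analytic_curve (R : realType) (n : nat) (a b : R)
    (gamma : R -> 'cV[R]_n) : Prop :=
  is_curve a b gamma /\
  forall i : 'I_n,
    {within `[a, b], continuous (fun t => gamma t i 0)} /\
    forall t0, t0 \in `]a, b[ -> real_analytic_at (fun t => gamma t i 0) t0.

Definition moment_curve (R : realType) (n : nat) (t : R) : 'cV[R]_n :=
  \col_(i < n) t ^+ i.+1.

(* Main.v *)
Require Import Defs.
From mathcomp Require Import all_boot all_order all_algebra.
From mathcomp Require Import all_classical all_reals all_analysis.
From mathcomp Require Import perm ring lra.
Import Order.TTheory GRing.Theory Num.Theory.
Import numFieldNormedType.Exports.
Set Implicit Arguments.
Unset Strict Implicit.
Unset Printing Implicit Defensive.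
Local Open Scope classical_set_scope.
Local Open Scope ring_scope.

(** Notation: [eta t = (t, t^2, .., t^n)] is the moment curve, [K] the image of
    [gamma].

    The substitution [t -> r t + s] acts on the moment curve as an affine map of
    R^n whose linear part has entries of size O(r). Cutting a parameter interval
    into m equal pieces therefore exhibits every affine image of an arc of [eta]
    as a self-affine set, once m is so large that all maps contract
    ([moment_arc_self_affine]).

    Conversely, let [E] be a non-trivial self-affine subset of [K]. Consider
    the semigroup of affine contractions that map [E] into itself; no point is
    fixed by all of it ([not_all_fix]). Fixed points of such maps are plentiful,
    so one of the maps, [g], has a fixed point [p] which is not an end point of
    the curve and at which [gamma] has a nonzero derivative for every
    parameter of [p] ([regular_fixed_point]). The orbit of a point of [E] under
    [g] converges to [p] inside [K]. Several branches of the curve may pass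
    through [p], but for some L > 0 the orbit comes back after exactly L steps
    to a single branch, at infinitely many times ([recurrent_parameter]).

    Let [T] be the linear part of [g^L]. A linear functional [u], restricted to
    that branch, vanishes at [p] to a finite order. Comparing the two sides of
    [u (T (gamma (t_k) - p)) = u (gamma (t_k') - p)] along the orbit shows that
    [u -> u T] preserves this order d and multiplies the leading coefficient by
    [mu ^ d], where [mu] is the eigenvalue of [T] on the tangent line and
    0 < |mu| < 1 ([leading_mul_exists], [multiplier_lt1]). Hence [T] is
    diagonalizable with pairwise distinct eigenvalues [mu ^ d_j]
    ([eigenbasis_of_orders]); one of the d_j is 1 because [gamma] is regular.
    In the eigencoordinates y_j, with y the one of order 1, the relation
    [y_j = C_j y ^ d_j] holds along the orbit, so by analyticity it holds on the
    whole curve ([monomial_coordinates]).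

    Thus [K] is an affine image of an arc of [s -> (s ^ d_j)_j]. A map of the
    semigroup that moves [p] sends infinitely many points of this curve to the
    curve. Its coordinates are polynomials Q_j with Q_j = Q ^ d_j, where Q is the
    one of exponent 1; comparing degrees, Q is affine with a nonzero constant
    term, and the expansion of its top power shows that the d_j are 1, .., n
    ([exponents_consecutive]). *)

(** * Taylor expansions of analytic functions *)

(** Analyticity at 0 with explicit constants: the remainders of all orders are
    geometric, uniformly near 0. In this form a product is treated with finite
    sums only. *)
Definition taylor {R : realType} (g : R -> R) (c : R^nat) (M A : R) : Prop :=
  0 < A /\ forall x, `|x| * A <= 2^-1 -> forall N,
    `|g x - \sum_(k < N) c k * x ^+ k| <= M * (`|x| * A) ^+ N.

Lemma taylor_ge0 {R : realType} (g : R -> R) c M A : taylor g c M A -> 0 <= M.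
Proof.
case=> A0 /(_ 0); rewrite normr0 mul0r => /(_ _ 0%N).
by rewrite big_ord0 subr0 expr0 mulr1 => h; apply: le_trans (h _) => //; lra.
Qed.

Lemma taylor_widen {R : realType} (g : R -> R) c M A B :
  A <= B -> taylor g c M A -> taylor g c M B.
Proof.
move=> AB h; have M0 := taylor_ge0 h; case: h => A0 h.
have xAB (x : R) : `|x| * A <= `|x| * B by rewrite ler_wpM2l.
split=> [|x xB N]; first exact: lt_le_trans AB.
apply: le_trans (h x (le_trans (xAB x) xB) N) _.
by apply: ler_wpM2l => //; apply: lerXn2r => //;
  rewrite nnegrE mulr_ge0 // ?ltW // (lt_le_trans A0 AB).
Qed.


(** The tail of order N is dominated by a geometric series of ratio at most 1/2,
    hence by twice its first term. *)
Lemma pseries_taylor {R : realType} (g : R -> R) (c : R^nat) (M A : R) :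
  0 < A -> (forall k, `|c k| <= M * A ^+ k) ->
  (forall x, `|x| * A <= 2^-1 -> pseries c x @ \oo --> g x) ->
  taylor g c (2 * M) A.
Proof.
move=> A0 cM cg; split=> // x xA N.
have M0 : 0 <= M by have := cM 0%N; rewrite expr0 mulr1; apply: le_trans.
have := cg x xA; set S := pseries c x => Sg.
have SE n : S n = \sum_(k < n) c k * x ^+ k.
  by rewrite /S /pseries /series /= big_mkord.
rewrite -SE.
have y0 : 0 <= `|x| * A by rewrite mulr_ge0 // ltW.
have key n : `|S (n + N)%N - S N| <=
    2 * M * (`|x| * A) ^+ N - 2 * M * (`|x| * A) ^+ (n + N).
  elim: n => [|n ih]; first by rewrite add0n !subrr normr0.
  rewrite addSn SE big_ord_recr /= -SE.
  have -> : S (n + N)%N + c (n + N)%N * x ^+ (n + N) - S N =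
    (S (n + N)%N - S N) + c (n + N)%N * x ^+ (n + N) by ring.
  apply: le_trans (ler_normD _ _) _.
  have h1 : `|c (n + N)%N * x ^+ (n + N)| <= M * (`|x| * A) ^+ (n + N).
    by rewrite normrM normrX exprMn (mulrC (`|c _|)) mulrCA ler_wpM2l ?exprn_ge0.
  have h2 : (`|x| * A) ^+ (n + N).+1 <= 2^-1 * (`|x| * A) ^+ (n + N).
    by rewrite exprS ler_wpM2r ?exprn_ge0.
  have h3 : M * (`|x| * A) ^+ (n + N).+1 <= M * (2^-1 * (`|x| * A) ^+ (n + N)).
    by rewrite ler_wpM2l.
  lra.
have cvS : `|S (n + N)%N - S N| @[n --> \oo] --> `|g x - S N|.
  apply: cvg_norm; apply: cvgB; last exact: cvg_cst.
  by rewrite (cvg_shiftn N S).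
apply: (cvgr_to_le cvS).
apply: nearW => n; apply: le_trans (key n) _.
by rewrite gerBl mulr_ge0 // ?mulr_ge0 // exprn_ge0.
Qed.

Lemma taylor_pseries {R : realType} (g : R -> R) c M A x :
  taylor g c M A -> `|x| * A <= 2^-1 -> pseries c x @ \oo --> g x.
Proof.
move=> tg xA; have M0 := taylor_ge0 tg; case: tg => A0 /(_ x xA) h.
apply/cvgrPdist_le => e e0.
have y0 : 0 <= `|x| * A by rewrite mulr_ge0 // ltW.
have : geometric M (2^-1 : R) @ \oo --> 0.
  by apply: cvg_geometric; rewrite ger0_norm; lra.
move=> /cvgrPdist_le /(_ e e0); apply: filterS => n.
rewrite /geometric /= sub0r normrN ger0_norm; last by rewrite mulr_ge0 // exprn_ge0.
move=> hn; rewrite /pseries /series /= big_mkord.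
apply: le_trans (h n) _; apply: le_trans hn.
by apply: ler_wpM2l => //; apply: lerXn2r; rewrite ?nnegrE; lra.
Qed.

(** At a point where the series converges its terms are bounded, which bounds the
    coefficients geometrically. *)
Lemma analytic_taylor {R : realType} (g : R -> R) (t0 : R) :
  real_analytic_at g t0 ->
  exists c M A, taylor (fun x => g (t0 + x)) c M A /\
    forall k, `|c k| <= M * A ^+ k.
Proof.
move=> [c /nbhs_ballP [e /= e0 ce]].
have cv x : `|x| < e -> pseries c x @ \oo --> g (t0 + x).
  move=> xe; have := ce (t0 + x); rewrite addrAC subrr add0r; apply.
  by rewrite /ball /= opprD addrA subrr add0r normrN.
pose r := e / 2; have r0 : 0 < r by rewrite divr_gt0.
have re : r < e by rewrite /r; lra.
have /cv cr : `|r| < e by rewrite gtr0_norm.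
have [K [Kreal Kf]] := cvg_series_bounded (cvgP _ cr).
pose M := `|K + 1|.
have cM k : `|c k| <= M * (r^-1) ^+ k.
  have := Kf (K + 1); rewrite ltrDl => /(_ ltr01 k I) /=.
  rewrite normrM [X in _ * X]gtr0_norm ?exprn_gt0 // exprVn => h.
  rewrite ler_pdivlMr ?exprn_gt0 //; apply: le_trans h _; exact: ler_norm.
have M0 : 0 <= M by exact: normr_ge0.
have ri : 0 < r^-1 by rewrite invr_gt0.
exists c, (2 * M), r^-1; split.
  apply: pseries_taylor => // x; rewrite ler_pdivrMr // => h; apply: cv.
  by apply: le_lt_trans h _; lra.
move=> k; apply: le_trans (cM k) _; apply: ler_wpM2r; last by lra.
by rewrite exprn_ge0 // ltW.
Qed.

Lemma taylor_analytic {R : realType} (g : R -> R) (t0 : R) c M A :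
  taylor (fun x => g (t0 + x)) c M A -> real_analytic_at g t0.
Proof.
move=> tg; have A0 := tg.1; exists c; apply/nbhs_ballP.
exists (2^-1 / A) => /=; first by rewrite divr_gt0.
move=> t; rewrite /ball /= ltr_pdivlMr // distrC => h.
have := taylor_pseries tg (ltW h).
by rewrite subrKC.
Qed.

Lemma analytic_cst {R : realType} (y t0 : R) : real_analytic_at (fun=> y) t0.
Proof.
apply: (@taylor_analytic _ _ _ (fun k => if k is 0%N then y else 0) `|y| 1).
split=> [//|x _ [|N]]; first by rewrite big_ord0 subr0 expr0 mulr1.
rewrite big_ord_recl big1 => [|i _]; last by rewrite /= mul0r.
by rewrite expr0 mulr1 addr0 subrr normr0 mulr_ge0 // exprn_ge0 // mulr1.
Qed.

Lemma analyticD {R : realType} (g h : R -> R) (t0 : R) :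
  real_analytic_at g t0 -> real_analytic_at h t0 ->
  real_analytic_at (fun t => g t + h t) t0.
Proof.
move=> [c gc] [d hd]; exists (fun k => c k + d k).
apply: filterS2 gc hd => t gt ht.
rewrite (_ : pseries _ _ = (pseries c (t - t0) \+ pseries d (t - t0))).
  exact: cvgD.
apply/funext => N; rewrite /pseries /series /= -big_split /=.
by apply: eq_bigr => k _; rewrite mulrDl.
Qed.

Lemma analyticZ {R : realType} (a : R) (g : R -> R) (t0 : R) :
  real_analytic_at g t0 -> real_analytic_at (fun t => a * g t) t0.
Proof.
move=> [c gc]; exists (fun k => a * c k).
apply: filterS gc => t gt.
rewrite (_ : pseries _ _ = (fun N => a * pseries c (t - t0) N)).
  exact: cvgMl_tmp.
apply/funext => N; rewrite /pseries /series /= mulr_sumr.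
by apply: eq_bigr => k _; rewrite mulrA.
Qed.

Lemma analytic_sum {R : realType} (I : finType) (g : I -> R -> R) (t0 : R) :
  (forall i, real_analytic_at (g i) t0) ->
  real_analytic_at (fun t => \sum_i g i t) t0.
Proof.
move=> ga; have : forall r : seq I, real_analytic_at (fun t => \sum_(i <- r) g i t) t0.
  elim=> [|i r ih].
    under [X in real_analytic_at X _]eq_fun do rewrite big_nil.
    exact: analytic_cst.
  under [X in real_analytic_at X _]eq_fun do rewrite big_cons.
  exact: analyticD.
by apply.
Qed.

(** The truncated Cauchy product, summed row by row: then each row involves one
    partial sum of the first factor. *)
Lemma cauchy_rows {R : comPzRingType} (a b : nat -> R) (x : R) N :
  \sum_(k < N) (\sum_(j < k.+1) b j * a (k - j)%N) * x ^+ k =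
  \sum_(j < N) b j * x ^+ j * \sum_(i < N - j) a i * x ^+ i.
Proof.
elim: N => [|N ih]; first by rewrite !big_ord0.
rewrite big_ord_recr [RHS]big_ord_recr /= ih subSnn big_ord1 expr0 mulr1.
rewrite big_ord_recr /= mulrDl addrA subnn mulrAC; congr (_ + _).
rewrite mulr_suml -big_split /=; apply: eq_bigr => j _.
rewrite subSn ?(ltnW (ltn_ord j)) // big_ord_recr /= mulrDr; congr (_ + _).
by rewrite mulrACA -exprD subnKC // ltnW.
Qed.

(** The remainder of the product is [g] times a remainder of [h], plus N rows each
    containing a remainder of [g]. All these terms are O((|x| A)^N), and their
    number N + 1 is absorbed by doubling A. *)
Lemma taylorM {R : realType} (g h : R -> R) (a b : R^nat) (M A K : R) :
  taylor g a M A -> taylor h b M A -> (forall k, `|b k| <= K * A ^+ k) ->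
  taylor (fun x => g x * h x) (fun k => \sum_(j < k.+1) b j * a (k - j)%N)
    (M * (M + K)) (2 * A).
Proof.
move=> ga hb bK; have M0 := taylor_ge0 ga; case: ga => A0 ga.
case: hb => _ hb; split=> [|x xA N]; first by rewrite mulr_gt0.
have xA' : `|x| * A <= 2^-1.
  apply: le_trans xA; rewrite ler_wpM2l //; lra.
have y0 : 0 <= `|x| * A by rewrite mulr_ge0 // ltW.
have K0 : 0 <= K by have := bK 0%N; rewrite expr0 mulr1; apply: le_trans.
rewrite cauchy_rows.
have -> : g x * h x - \sum_(j < N) b j * x ^+ j * (\sum_(i < N - j) a i * x ^+ i)
  = g x * (h x - \sum_(j < N) b j * x ^+ j) + \sum_(j < N) b j * x ^+ j *
      (g x - \sum_(i < N - j) a i * x ^+ i).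
  under [X in _ = _ + X]eq_bigr do rewrite mulrBr.
  by rewrite sumrB -mulr_suml; ring.
have gM : `|g x| <= M by have := ga x xA' 0%N; rewrite big_ord0 subr0 expr0 mulr1.
have e1 : `|g x * (h x - \sum_(j < N) b j * x ^+ j)| <= M * M * (`|x| * A) ^+ N.
  by rewrite normrM -mulrA; apply: ler_pM => //; exact: hb.
have e2 : `|\sum_(j < N) b j * x ^+ j * (g x - \sum_(i < N - j) a i * x ^+ i)|
    <= N%:R * (M * K * (`|x| * A) ^+ N).
  apply: le_trans (ler_norm_sum _ _ _) _.
  apply: (@le_trans _ _ (\sum_(j < N) M * K * (`|x| * A) ^+ N)); last first.
    by rewrite sumr_const card_ord mulr_natl.
  apply: ler_sum => j _; rewrite normrM.
  apply: (@le_trans _ _ ((K * (`|x| * A) ^+ j) * (M * (`|x| * A) ^+ (N - j)))).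
    apply: ler_pM => //; last exact: ga.
    rewrite normrM normrX exprMn mulrCA mulrC.
    by apply: ler_wpM2l; rewrite ?exprn_ge0.
  by rewrite mulrACA (mulrC K) -exprD subnKC // ltnW.
apply: le_trans (ler_normD _ _) _; apply: le_trans (lerD e1 e2) _.
have -> : `|x| * (2 * A) = 2 * (`|x| * A) by ring.
rewrite [(2 * _) ^+ N]exprMn.
have N2 : N%:R <= (2 : R) ^+ N by rewrite -natrX ler_nat ltnW // ltn_expl.
have N1 : 1 <= (2 : R) ^+ N by apply: exprn_ege1; lra.
have -> : M * M * (`|x| * A) ^+ N + N%:R * (M * K * (`|x| * A) ^+ N) =
  M * (M + N%:R * K) * (`|x| * A) ^+ N by ring.
rewrite mulrA ler_wpM2r ?exprn_ge0 // -mulrA ler_wpM2l //.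
rewrite mulrDl lerD // ?ler_peMr //.
by rewrite mulrC ler_wpM2l.
Qed.

Lemma analyticM {R : realType} (g h : R -> R) (t0 : R) :
  real_analytic_at g t0 -> real_analytic_at h t0 ->
  real_analytic_at (fun t => g t * h t) t0.
Proof.
move=> /analytic_taylor [a [M [A [ga _]]]] /analytic_taylor [b [N [B [hb bN]]]].
have A0 := ga.1; have B0 := hb.1.
have AC : A <= A + B by lra.
have BC : B <= A + B by lra.
have M0 := taylor_ge0 ga; have N0 := taylor_ge0 hb.
have up (f : R -> R) c (K L C : R) : K <= L -> taylor f c K C -> taylor f c L C.
  move=> KL [C0 fc]; split=> // x xC n; apply: le_trans (fc x xC n) _.
  by rewrite ler_wpM2r // exprn_ge0 // mulr_ge0 // ltW.
have ga' : taylor (fun x => g (t0 + x)) a (M + N) (A + B).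
  by apply: up (taylor_widen AC ga); lra.
have hb' : taylor (fun x => h (t0 + x)) b (M + N) (A + B).
  by apply: up (taylor_widen BC hb); lra.
apply: taylor_analytic (taylorM ga' hb' (K := N) _) => k.
apply: le_trans (bN k) _; rewrite ler_wpM2l // lerXn2r // nnegrE; lra.
Qed.

Lemma analyticX {R : realType} (g : R -> R) (t0 : R) n :
  real_analytic_at g t0 -> real_analytic_at (fun t => g t ^+ n) t0.
Proof.
move=> ga; elim: n => [|n ih]; first exact: analytic_cst.
under [X in real_analytic_at X _]eq_fun do rewrite exprS.
exact: analyticM.
Qed.

(** * Leading terms and the identity principle *)

(** If the coefficients below d vanish, the partial sum of length d + 1 is the
    monomial c_d x^d, and the remainder is O(x^(d+1)). *)
Lemma taylor_lead {R : realType} (g : R -> R) c M A d :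
  taylor g c M A -> (forall k, (k < d)%N -> c k = 0) ->
  g x / x ^+ d @[x --> 0^'] --> c d.
Proof.
move=> tg c0; have M0 := taylor_ge0 tg; case: tg => A0 h.
apply/cvgrPdist_le => e e0.
pose K := M * A ^+ d.+1 + 1; have K0 : 0 < K.
  by rewrite ltr_wpDl // mulr_ge0 // exprn_ge0 // ltW.
have r0 : 0 < Num.min (2^-1 / A) (e / K) by rewrite lt_min !divr_gt0.
near=> x.
have x0 : x != 0 by near: x; exact: nbhs_dnbhs_neq.
have : `|x| < Num.min (2^-1 / A) (e / K).
  near: x; apply: dnbhs0_lt; exact: r0.
rewrite lt_min !ltr_pdivlMr // => /andP[xA xe].
have := h x (ltW xA) d.+1.
rewrite big_ord_recr /= big1 ?add0r => [|i _]; last by rewrite c0 // mul0r.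
move=> hx.
have -> : c d - g x / x ^+ d = - ((g x - c d * x ^+ d) / x ^+ d).
  by rewrite mulrBl mulfK ?expf_neq0 // opprB.
rewrite normrN normrM normfV normrX ler_pdivrMr ?exprn_gt0 ?normr_gt0 //.
apply: le_trans hx _; rewrite exprMn mulrCA exprSr -mulrA.
rewrite [leRHS]mulrC ler_wpM2l ?exprn_ge0 //.
apply: le_trans (ltW xe); rewrite ler_wpM2l //.
by rewrite /K; lra.
Unshelve. all: by end_near. Qed.

Lemma taylor_zero {R : realType} (g : R -> R) c M A :
  taylor g c M A -> (forall k, c k = 0) -> \forall x \near 0, g x = 0.
Proof.
move=> tg c0; have A0 := tg.1; have e0 : 0 < 2^-1 / A by exact: divr_gt0.
near=> x; have xA : `|x| * A <= 2^-1.
  by rewrite -ler_pdivlMr //; near: x; exact: nbhs0_le e0.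
have := taylor_pseries tg xA.
rewrite (_ : pseries c x = fun=> 0); first by move/cvg_lim => <- //; rewrite lim_cst.
by apply/funext => N; rewrite /pseries /series /= big1 // => k _; rewrite c0 mul0r.
Unshelve. all: by end_near. Qed.

Lemma first_nonzero {R : realType} (c : R^nat) :
  (forall k, c k = 0) \/
  exists2 d, c d != 0 & forall k, (k < d)%N -> c k = 0.
Proof.
have [ck|h] := pselect (exists k, c k != 0); [right|left].
  have [d cd dmin] := ex_minnP ck.
  by exists d => // j; apply: contraTeq => /dmin; rewrite leqNgt.
by move=> k; apply/eqP/negP => /negP ck; apply: h; exists k.
Qed.

(** Either all Taylor coefficients of [g - g t0] vanish, or the first nonzero one
    gives the leading term; it is not the coefficient of index 0. *)
Lemma analytic_increment {R : realType} (g : R -> R) t0 :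
  real_analytic_at g t0 ->
  (\forall t \near t0, g t = g t0) \/
  exists d l, l != 0 /\ (g (t0 + x) - g t0) / x ^+ d.+1 @[x --> 0^'] --> l.
Proof.
move=> ga.
have [c [M [A [tc _]]]] := analytic_taylor (analyticD ga (analytic_cst (- g t0) t0)).
have [c0|[[|d] cd cmin]] := first_nonzero c.
- left; apply/(nbhs0P (fun t => g t = g t0)).
  by apply: filterS (taylor_zero tc c0) => x /eqP; rewrite subr_eq0 => /eqP.
- case/eqP: cd; have := tc.2 0; rewrite normr0 mul0r => /(_ _ 1%N).
  rewrite big_ord1 addr0 subrr sub0r expr0 expr1 mulr1 mulr0 normrN.
  by move=> h; apply/eqP; rewrite -normr_le0 h // invr_ge0.
- by right; exists d, (c d.+1); split => //; exact: taylor_lead tc cmin.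
Qed.

Lemma dnbhs0P {R : realType} (P : set R) (t : R) :
  (\forall x \near 0^', P (t + x)) <-> (\forall s \near t^', P s).
Proof.
split=> h; last first.
  have {}h : \forall x \near 0, t + x != t -> P (t + x).
    by rewrite -(nbhs0P (fun s => s != t -> P s)); exact: h.
  apply: filterS h => x h x0; apply: h.
  by apply: contraNneq x0 => /eqP; rewrite -subr_eq0 addrAC subrr add0r.
suff : \forall s \near t, s != t -> P s by [].
rewrite (nbhs0P (fun s => s != t -> P s)).
have {}h : \forall x \near 0, x != 0 -> P (t + x) by exact: h.
apply: filterS h => x h xt; apply: h.
by apply: contraNneq xt => ->; rewrite addr0.
Qed.

Lemma pseries_geo_cvg {R : realType} (c : R^nat) (M A x : R) :
  0 < A -> (forall k, `|c k| <= M * A ^+ k) -> `|x| * A < 1 ->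
  cvgn (pseries c x).
Proof.
move=> A0 cM xA; apply: normed_cvg.
have y0 : 0 <= `|x| * A by rewrite mulr_ge0 // ltW.
have M0 : 0 <= M by have := cM 0%N; rewrite expr0 mulr1; apply: le_trans.
apply: (@series_le_cvg _ _ (geometric M (`|x| * A))) => [k|k|k|].
- exact: normr_ge0.
- by rewrite /geometric /= mulr_ge0 // exprn_ge0.
- rewrite /geometric /= normrM normrX exprMn mulrCA mulrC.
  by apply: ler_wpM2l; rewrite ?exprn_ge0.
- by apply: is_cvg_geometric_series; rewrite ger0_norm.
Qed.

(** Differentiation multiplies coefficients by k + 1 <= 2^k: the derived series is
    again geometrically bounded. *)
Lemma diffs_bound {R : realType} (c : R^nat) (M A : R) :
  0 < A -> (forall k, `|c k| <= M * A ^+ k) ->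
  forall k, `|pseries_diffs c k| <= (M * A) * (2 * A) ^+ k.
Proof.
move=> A0 cM k; rewrite /pseries_diffs normrM normr_nat.
have k2 : k.+1%:R <= (2 : R) ^+ k by rewrite -natrX ler_nat ltn_expl.
apply: le_trans (ler_pM _ _ k2 (cM k.+1)) _ => //.
by rewrite exprMn exprS; lra.
Qed.

(** The derivative is again analytic, so its zeros are isolated unless all its
    Taylor coefficients vanish, in which case the function is locally constant. *)
Lemma analytic_regular_near {R : realType} (g : R -> R) t0 :
  real_analytic_at g t0 ->
  (\forall t \near t0, g t = g t0) \/
  \forall t \near t0^', exists2 l : R, l != 0 & (g (t + x) - g t) / x @[x --> 0^'] --> l.
Proof.
move=> ga; have [c [M [A [tc cM]]]] := analytic_taylor ga.
have A0 := tc.1; pose D x : R := limn (pseries (pseries_diffs c) x).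
have dM := diffs_bound A0 cM; have A20 : 0 < 2 * A by lra.
have ddM := diffs_bound A20 dM; have A40 : 0 < 2 * (2 * A) by lra.
have tD : taylor D (pseries_diffs c) (2 * (M * A)) (2 * A).
  apply: pseries_taylor => // x xA.
  by apply: (@pseries_geo_cvg _ _ (M * A) (2 * A)) => //; lra.
have [d0|[d dd dmin]] := first_nonzero (pseries_diffs c).
  left; apply/(nbhs0P (fun t => g t = g t0)).
  have c0 k : c k.+1 = 0.
    by have /eqP := d0 k; rewrite mulf_eq0 pnatr_eq0 /= => /eqP.
  have g0 : g t0 = c 0%N.
    have := tc.2 0; rewrite normr0 mul0r => /(_ _ 1%N).
    rewrite big_ord1 addr0 expr0 expr1 mulr1 mulr0 => h.
    by apply/eqP; rewrite -subr_eq0 -normr_le0 h // invr_ge0.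
  have tc' : taylor (fun x => g (t0 + x) - g t0) (fun=> 0) M A.
    split=> // x xA N; rewrite big1 ?subr0 => [|i _]; last by rewrite mul0r.
    have := tc.2 x xA N.+1.
    rewrite big_ord_recl big1 => [|i _]; last by rewrite c0 mul0r.
    rewrite expr0 mulr1 addr0 -g0 => h; apply: le_trans h _.
    rewrite exprS ler_wpM2l ?(taylor_ge0 tc) //.
    rewrite ler_piMl ?exprn_ge0 // ?mulr_ge0 ?(ltW A0) //; lra.
  apply: filterS (taylor_zero tc' (fun=> erefl)) => x /eqP.
  by rewrite subr_eq0 => /eqP.
right.
(* 8 A dominates the rates A, 2 A and 4 A of the series and its first two
   derivatives *)
pose K := (8 * A)^-1; have K0 : 0 < K by rewrite invr_gt0; lra.
have KA : `|K| * (8 * A) = 1 by rewrite gtr0_norm // mulVf //; lra.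
have dg (x : R) : `|x| < K -> is_derive x (1 : R) (fun y => g (t0 + y)) (D x).
  move=> xK.
  have : is_derive x (1 : R) (fun y => limn (pseries c y)) (D x).
    apply: (@pseries_snd_diffs _ c K x); last by rewrite [X in _ < X]gtr0_norm.
    - apply: (pseries_geo_cvg A0 cM); lra.
    - apply: (pseries_geo_cvg A20 dM); lra.
    - apply: (pseries_geo_cvg A40 ddM); lra.
  apply: near_eq_is_derive; near=> y; apply/cvg_lim => //.
  apply: (taylor_pseries tc).
  have yK : `|y| <= K.
    near: y; have := @cvgr_norm_le _ _ _ (nbhs x) _ id x.
    by apply; [exact: cvg_id|].
  apply: le_trans (ler_wpM2r (ltW A0) yK) _.
  by move: KA; rewrite gtr0_norm //; lra.
have D0 : \forall x \near 0^', D x / x ^+ d != 0.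
  exact: cvgr_neq0 (taylor_lead tD dmin) dd.
apply/dnbhs0P; near=> x; exists (D x).
  have : D x / x ^+ d != 0 by near: x.
  by apply: contraNneq => ->; rewrite mul0r.
have xK : `|x| < K by near: x; exact: dnbhs0_lt.
have [] := dg x xK; rewrite /derivable /derive => /cvg_ex [l /= cl] dl.
have <- : l = D x by rewrite -dl; apply/esym/cvg_lim.
apply: cvg_trans cl; apply: near_eq_cvg; near=> h.
have -> : h%:A = h by exact: mulr1.
by rewrite [h + x]addrC addrA; exact: mulrC.
Unshelve. all: by end_near. Qed.

Lemma analytic_zeros_isolated {R : realType} (h : R -> R) t0 :
  real_analytic_at h t0 ->
  (\forall t \near t0, h t = 0) \/ (\forall t \near t0^', h t != 0).
Proof.
move=> /analytic_taylor [c [M [A [tc _]]]].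
have [c0|[d cd dmin]] := first_nonzero c; [left|right].
  exact/(nbhs0P (fun t => h t = 0))/taylor_zero/c0/tc.
apply/dnbhs0P; apply: filterS (cvgr_neq0 _ (taylor_lead tc dmin) cd) => x.
by apply: contraNneq => ->; rewrite mul0r.
Qed.

(** The set where [h] vanishes locally is open, and it is closed in the interval
    because zeros of analytic functions are isolated otherwise. *)
Lemma identity_principle {R : realType} (h : R -> R) (a b t0 : R) :
  (forall t, t \in `]a, b[ -> real_analytic_at h t) -> t0 \in `]a, b[ ->
  ~ (\forall t \near t0^', h t != 0) ->
  forall t, t \in `]a, b[ -> h t = 0.
Proof.
move=> ha t0ab nz.
pose Z : set R := [set t : R | \forall s \near t, h s = 0].
have Zt0 : Z t0 by have [//|/nz] := analytic_zeros_isolated (ha _ t0ab).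
have ci : connected ([set` `]a, b[] : set R).
  by apply/connected_intervalP; exact: interval_is_interval.
have ZE : [set` `]a, b[] `&` Z = [set` `]a, b[].
  apply: ci.
  - by exists t0; split.
  - by exists Z => //; exact: (open_interior [set s | h s = 0]).
  - exists (closure Z); first exact: closed_closure.
    apply/seteqP; split=> t [tab Zt]; split=> //; first exact: subset_closure.
    have [//|nzt] := analytic_zeros_isolated (ha _ tab).
    have {}nzt : \forall s \near t, s != t -> h s != 0 by exact: nzt.
    have [s [Zs /= nzs]] := Zt _ (nbhs_interior nzt).
    have : \forall u \near s^', h u = 0 /\ (u != t -> h u != 0).
      by apply: nbhs_dnbhs; apply: filterI.
    have [->|st] := eqVneq s t; last first.
      by have := nbhs_singleton nzs st; rewrite (nbhs_singleton Zs) eqxx.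
    move=> hu; have : \forall u \near t^', u != t /\ h u = 0 /\ (u != t -> h u != 0).
      by apply: filterS2 (nbhs_dnbhs_neq t) hu => u ut [h0 hu].
    by move=> /filter_ex [u [ut [h0 /(_ ut)]]]; rewrite h0 eqxx.
move=> t tab; have [_ Zt] : ([set` `]a, b[] `&` Z) t by rewrite ZE.
exact: nbhs_singleton Zt.
Qed.

(** * Strict contractions of a compact set *)

Lemma exprn_cvg {R : realType} {S : Type} (F : set_system S) {FF : Filter F}
    (f : S -> R) (l : R) d : f @ F --> l -> f k ^+ d @[k --> F] --> l ^+ d.
Proof. by move=> fl; exact: (continuous_cvg _ (@exprn_continuous R _ _) fl). Qed.

Lemma cvg_sumr {R : realType} {S : Type} (F : set_system S) {FF : Filter F}
    (I : Type) (r : seq I) (f : I -> S -> R) (l : I -> R) :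
  (forall i, f i k @[k --> F] --> l i) ->
  \sum_(i <- r) f i k @[k --> F] --> \sum_(i <- r) l i.
Proof.
move=> h; elim: r => [|i r ih].
  by under eq_fun do rewrite big_nil; rewrite big_nil; exact: cvg_cst.
by under eq_fun do rewrite big_cons; rewrite big_cons; exact: cvgD.
Qed.

Lemma cvg_coord {R : realType} {S : Type} (F : set_system S) {FF : Filter F} {n}
    (f : S -> 'cV[R]_n) (y : 'cV[R]_n) :
  (forall i, f k i 0 @[k --> F] --> y i 0) -> f @ F --> y.
Proof.
move=> h; apply/cvgrPdist_le => e e0.
have : \forall k \near F, forall i, `|y i 0 - f k i 0| <= e.
  by apply: filter_forall => i; have /cvgrPdist_le := h i; apply.
apply: filterS => k hk; rewrite /Num.norm /= mx_normrE.
apply/bigmax_leP; split=> [|[i j] _]; first exact: ltW.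
by rewrite !mxE ord1 /=; exact: hk.
Qed.

Lemma enorm_ge0 {R : realType} {n} (y : 'cV[R]_n) : 0 <= enorm y.
Proof. exact: sqrtr_ge0. Qed.

Lemma coord_le_enorm {R : realType} {n} (y : 'cV[R]_n) i : `|y i 0| <= enorm y.
Proof.
rewrite -sqrtr_sqr ler_wsqrtr // (bigD1 i) //= lerDl.
by apply: sumr_ge0 => j _; exact: sqr_ge0.
Qed.

Lemma enorm_eq0 {R : realType} {n} (y : 'cV[R]_n) : enorm y = 0 -> y = 0.
Proof.
move=> y0; apply/colP => i; rewrite mxE; apply/eqP.
by rewrite -normr_le0 -y0 coord_le_enorm.
Qed.

Lemma enorm0 {R : realType} {n} : enorm (0 : 'cV[R]_n) = 0.
Proof. by rewrite /enorm big1 ?sqrtr0 // => i _; rewrite mxE expr0n. Qed.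

Lemma enormZ {R : realType} {n} (a : R) (y : 'cV[R]_n) : enorm (a *: y) = `|a| * enorm y.
Proof.
rewrite /enorm; under eq_bigr do rewrite mxE exprMn.
by rewrite -mulr_sumr sqrtrM ?sqr_ge0 // sqrtr_sqr.
Qed.

Lemma enorm_continuous {R : realType} {n} : continuous (@enorm R n).
Proof.
move=> y.
apply: (@continuous_cvg _ _ _ (nbhs y) _ _ _ _ (@sqrt_continuous R _)).
apply: (@cvg_sumr _ _ (nbhs y)) => i; apply: (@exprn_cvg _ _ (nbhs y)).
exact: coord_continuous.
Qed.

Lemma enorm_cvg {R : realType} {S : Type} (F : set_system S) {FF : Filter F} {n}
    (f g : S -> 'cV[R]_n) (y z : 'cV[R]_n) :
  f @ F --> y -> g @ F --> z -> enorm (f k - g k) @[k --> F] --> enorm (y - z).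
Proof.
move=> fy gz; apply: (continuous_cvg _ (@enorm_continuous R n _)).
exact: cvgB.
Qed.

Lemma cvg_enorm {R : realType} {S : Type} (F : set_system S) {FF : Filter F} {n}
    (f : S -> 'cV[R]_n) (y : 'cV[R]_n) :
  enorm (f k - y) @[k --> F] --> 0 -> f @ F --> y.
Proof.
move=> h; apply: cvg_coord => i.
apply/cvgrPdist_le => e e0; move/cvgrPdist_le : h => /(_ _ e0).
apply: filterS => k; rewrite sub0r normrN ger0_norm ?enorm_ge0 //.
apply: le_trans; rewrite distrC.
by have := coord_le_enorm (f k - y) i; rewrite !mxE.
Qed.

Lemma contractive_continuous {R : realType} {n} (g : 'cV[R]_n -> 'cV[R]_n) :
  strictly_contractive g -> continuous g.
Proof.
move=> gc y; apply: (@cvg_enorm _ _ (nbhs y)).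
have h : enorm (z - y) @[z --> y] --> 0.
  rewrite -[X in _ --> X](@enorm0 R n) -(subrr y).
  by apply: (@enorm_cvg _ _ (nbhs y)); [exact: cvg_id|exact: cvg_cst].
apply: (@squeeze_cvgr _ _ _ _ (fun=> 0) (fun z => enorm (z - y))) => //; last exact: cvg_cst.
apply: nearW => z; rewrite enorm_ge0 /=.
by have [->|zy] := eqVneq z y; [rewrite !subrr|exact/ltW/gc].
Qed.

Lemma affine_linear_part {R : realType} {n} (f : 'cV[R]_n -> 'cV[R]_n) :
  invertible_affine_map f ->
  exists (T : 'M[R]_n) v, T \in unitmx /\ forall x, f x = T *m x + v.
Proof.
move=> [[T [v fE]] fbij]; exists T, v; split=> //.
rewrite -unitmx_tr -row_free_unit; apply: inj_row_free => u uT.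
apply: trmx_inj; apply: (bij_inj fbij); rewrite !fE trmx0 mulmx0.
by rewrite -[T]trmxK -trmx_mul uT trmx0.
Qed.

Lemma affine_invertible {R : realType} {n} (f : 'cV[R]_n -> 'cV[R]_n) (T : 'M[R]_n) v :
  T \in unitmx -> (forall x, f x = T *m x + v) -> invertible_affine_map f.
Proof.
move=> Tu fE; split; first by exists T, v.
exists (fun y => invmx T *m (y - v)) => x; rewrite fE.
  by rewrite addrK mulKmx.
by rewrite mulKVmx // subrK.
Qed.

(** The maps of an affine system with attractor E are of this kind, and so are their
    compositions: the argument takes place in this semigroup. *)
Definition selfmap {R : realType} {n} (E : set 'cV[R]_n) (g : 'cV[R]_n -> 'cV[R]_n) :=
  [/\ strictly_contractive g, invertible_affine_map g & forall x, E x -> E (g x)].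

Lemma contractive_le {R : realType} {n} (g : 'cV[R]_n -> 'cV[R]_n) x y :
  strictly_contractive g -> enorm (g x - g y) <= enorm (x - y).
Proof.
by move=> gc; have [->|xy] := eqVneq x y; [rewrite !subrr|exact/ltW/gc].
Qed.

Lemma selfmap_comp {R : realType} {n} (E : set 'cV[R]_n) g h :
  selfmap E g -> selfmap E h -> selfmap E (g \o h).
Proof.
move=> [gc gi gE] [hc hi hE]; split=> [x y xy||x Ex]; last exact/gE/hE.
  exact: le_lt_trans (contractive_le _ _ gc) (hc _ _ xy).
have [T [v [Tu gT]]] := affine_linear_part gi.
have [U [w [Uu hU]]] := affine_linear_part hi.
apply: (@affine_invertible _ _ _ (T *m U) (T *m w + v)).
  by rewrite unitmx_mul Tu.
by move=> x; rewrite /= gT hU mulmxDr mulmxA addrA.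
Qed.

Lemma selfmap_iter_comp {R : realType} {n} (E : set 'cV[R]_n) g h k :
  selfmap E g -> selfmap E h -> selfmap E (iter k g \o h).
Proof.
by move=> sg sh; elim: k => [//|k ih]; exact: (selfmap_comp sg ih).
Qed.

(** If the point of E that g moves least were not fixed, its image would be moved
    strictly less. *)
Lemma selfmap_fixed {R : realType} {n} (E : set 'cV[R]_n) g :
  E !=set0 -> compact E -> selfmap E g -> exists2 p, E p & g p = p.
Proof.
move=> E0 cE [gc gi gE].
have cf : continuous (fun x => enorm (g x - x)).
  move=> x; apply: (@enorm_cvg _ _ (nbhs x)); last exact: cvg_id.
  exact: contractive_continuous.
have [p pE pmin] := compact_EVT_min E0 cE (continuous_subspaceT cf).
rewrite inE in pE; exists p => //; apply/eqP/negP => /negP gp.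
have := pmin (g p); rewrite inE => /(_ (gE _ pE)).
by rewrite leNgt (gc _ _ gp).
Qed.

(** Ultrafilters on the integers play the part of subsequences: along one of them,
    countably many sequences of a compact set converge at once. *)
Lemma ultra_compact_cvg {S : Type} {X : topologicalType} (U : set_system S)
    {UU : UltraFilter U} (E : set X) (f : S -> X) :
  compact E -> (\forall k \near U, E (f k)) -> exists2 z, E z & f @ U --> z.
Proof.
move=> cE Ef; have [z [Ez cz]] := cE _ (fmap_proper_filter f _) Ef.
exists z => // A zA; have [//|nA] := in_ultra_setVsetC (f @^-1` A) UU.
have [y [/= nAy Ay]] := cz (~` A) A nA zA.
by case: nAy.
Qed.

Lemma ultra_extends_oo : exists2 U : set_system nat, UltraFilter U & U --> \oo.
Proof. by have [U [UU hU]] := @ultraFilterLemma _ \oo _; exists U. Qed.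

Lemma iter_fixed {X : Type} (g : X -> X) (p : X) k : g p = p -> iter k g p = p.
Proof. by move=> gp; elim: k => //= k ->. Qed.

Lemma iter_closer {R : realType} {n} (g : 'cV[R]_n -> 'cV[R]_n) p y m :
  strictly_contractive g -> g p = p -> y != p ->
  enorm (iter m.+1 g y - p) < enorm (y - p).
Proof.
move=> gc gp yp; rewrite iterSr.
have le_iter z : enorm (iter m g z - p) <= enorm (z - p).
  elim: m => [//|m ih]; apply: le_trans ih.
  by have := contractive_le (iter m g z) p gc; rewrite gp.
by apply: le_lt_trans (le_iter (g y)) _; have := gc _ _ yp; rewrite gp.
Qed.

Lemma orbit_neq {X : eqType} (g : X -> X) (p q : X) k :
  injective g -> g p = p -> q != p -> iter k g q != p.
Proof.
move=> ginj gp qp; elim: k => [//|k]; apply: contraNneq => h.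
by apply/eqP/ginj; rewrite gp.
Qed.

Lemma orbit_injective {R : realType} {n} (g : 'cV[R]_n -> 'cV[R]_n) p q :
  strictly_contractive g -> injective g -> g p = p -> q != p ->
  injective (fun k => iter k g q).
Proof.
move=> gc ginj gp qp.
have lt k m : (k < m)%N -> enorm (iter m g q - p) < enorm (iter k g q - p).
  move=> km; rewrite -(subnK km) addnS -addSn iterD.
  by apply: iter_closer => //; exact: orbit_neq.
move=> k m /= e; have [/lt|/lt|//] := ltngtP k m; by rewrite e ltxx.
Qed.

(** The distances to p decrease to a limit. A limit point z of the orbit and its
    image g z both lie at this distance from p, so that z = p. *)
Lemma iterates_to_fixed {R : realType} {n} (E : set 'cV[R]_n) g p q :
  compact E -> selfmap E g -> g p = p -> E q ->
  enorm (iter k g q - p) @[k --> \oo] --> 0.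
Proof.
move=> cE [gc gi gE] gp Eq.
have Ek k : E (iter k g q) by elim: k => //= k; exact: gE.
pose a k := enorm (iter k g q - p).
have ni : nonincreasing_seq a.
  apply/nonincreasing_seqP => k; rewrite /a iterS -[in leLHS]gp.
  exact: contractive_le.
have al : cvgn a.
  apply: nonincreasing_is_cvgn => //; exists 0 => _ [k _ <-]; exact: enorm_ge0.
have [U UU Uoo] := ultra_extends_oo.
have [z Ez qz] : exists2 z, E z & iter k g q @[k --> U] --> z.
  by apply: (ultra_compact_cvg cE); exact: nearW.
have e1 : enorm (z - p) = limn a.
  apply: (@cvg_unique _ (@Rhausdorff R) (a @ U)); last exact: cvg_trans (cvg_app _ Uoo) al.
  by apply: enorm_cvg => //; exact: cvg_cst.
have e2 : enorm (g z - p) = limn a.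
  apply: (@cvg_unique _ (@Rhausdorff R) (a k.+1 @[k --> U])).
    apply: enorm_cvg; last exact: cvg_cst.
    exact: (cvg_comp (fun k => iter k g q) g qz (@contractive_continuous _ _ _ gc z)).
  apply: cvg_trans (cvg_app _ Uoo) _.
  by rewrite cvg_shiftS.
have zp : z = p.
  apply/eqP/negP => /negP zp; have := gc _ _ zp.
  by rewrite gp e1 e2 ltxx.
by rewrite -/a; rewrite zp subrr enorm0 in e1; rewrite e1.
Qed.

(** As in Dini's theorem, pointwise monotone convergence of the distances is
    uniform on the compact set E. *)
Lemma iterates_uniform {R : realType} {n} (E : set 'cV[R]_n) g p (e : nat -> 'cV[R]_n) :
  compact E -> selfmap E g -> g p = p -> (forall k, E (e k)) ->
  iter k g (e k) @[k --> \oo] --> p.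
Proof.
move=> cE sg gp Ee; have [gc gi gE] := sg.
apply: cvg_enorm; apply/cvgrPdist_lt => r r0.
have ci k : continuous (iter k g).
  elim: k => [|k ih] y; first exact: cvg_id.
  exact: continuous_comp (ih y) (@contractive_continuous _ _ _ gc _).
suff : \forall k \near \oo, E `<=` (fun y => enorm (iter k g y - p) < r).
  by apply: filterS => k /(_ _ (Ee k)); rewrite sub0r normrN ger0_norm ?enorm_ge0.
have /compact_near_coveringP := cE; apply=> y Ey.
have := iterates_to_fixed cE sg gp Ey.
move=> /cvgrPdist_lt /(_ _ r0) [k0 _ /(_ k0 (leqnn _))].
rewrite /= sub0r normrN ger0_norm ?enorm_ge0 // => yk0.
have near_y : \forall y' \near y, enorm (iter k0 g y' - p) < r.
  have : enorm (iter k0 g y' - p) @[y' --> y] --> enorm (iter k0 g y - p).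
    by apply: (@enorm_cvg _ _ (nbhs y)); [exact: ci|exact: cvg_cst].
  by move/cvgr_lt; apply.
near=> y' k => /=.
have k0k : (k0 <= k)%N by near: k; exact: nbhs_infty_ge.
apply: (@le_lt_trans _ _ (enorm (iter k0 g y' - p))); last by near: y'.
rewrite -(subnK k0k) iterD; elim: (k - k0)%N => [//|m ih].
apply: le_trans ih; rewrite iterS -{1}gp; exact: contractive_le.
Unshelve. all: by end_near. Qed.

(** If all the maps fixed p, then the point of E farthest from p would be brought
    closer to p by the map it comes from, unless it is p. *)
Lemma not_all_fix {R : realType} {n l} (E : set 'cV[R]_n)
    (f : 'I_l -> 'cV[R]_n -> 'cV[R]_n) p :
  E !=set0 -> compact E -> affine_IFS f ->
  E = \bigcup_(i in [set: 'I_l]) (f i @` E) ->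
  ~ (exists x, E = [set x]) -> exists i, f i p != p.
Proof.
move=> E0 cE fI EU nE; apply: contrapT => /forallNP fixp.
have {}fixp i : f i p = p by apply/eqP/negP => /negP; exact: fixp.
have cf : continuous (fun x : 'cV[R]_n => enorm (x - p)).
  by move=> x; apply: (@enorm_cvg _ _ (nbhs x)); [exact: cvg_id|exact: cvg_cst].
have [q qE qmax] := compact_EVT_max E0 cE (continuous_subspaceT cf).
rewrite inE in qE; have [i _ [q' Eq' q'q]] : (\bigcup_(i in [set: 'I_l]) (f i @` E)) q.
  by rewrite -EU.
have q'p : q' = p.
  apply/eqP/negP => /negP q'p; have := (fI i).1 _ _ q'p.
  by rewrite fixp q'q ltNge qmax // inE.
have qp : q = p by rewrite -q'q q'p fixp.
apply: nE; exists p; apply/seteqP; split=> x /=; last by move=> ->; rewrite -qp.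
move=> Ex; apply/eqP; rewrite -subr_eq0; apply/eqP/enorm_eq0/eqP.
have := qmax x; rewrite inE qp subrr enorm0 => /(_ Ex).
by rewrite eq_le enorm_ge0 andbT.
Qed.

(** The point z_k is the fixed point of g^k h. It is in the image of g^k, hence
    close to x; and it is not x, because g^k h x = x = g^k x would give h x = x. *)
Lemma nearby_fixed_points {R : realType} {n} (E : set 'cV[R]_n) g h x :
  E !=set0 -> compact E -> selfmap E g -> selfmap E h -> g x = x -> h x != x ->
  exists z : nat -> 'cV[R]_n,
    [/\ z @ \oo --> x, forall k, z k != x & forall k, E (z k) /\
      exists2 g', selfmap E g' & g' (z k) = z k].
Proof.
move=> E0 cE sg sh gx hx.
have fixk k := selfmap_fixed E0 cE (selfmap_iter_comp k sg sh).
pose z k := s2val (cid2 (fixk k)).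
have Ez k : E (z k) := s2valP (cid2 (fixk k)).
have zk k : iter k g (h (z k)) = z k := s2valP' (cid2 (fixk k)).
exists z; split=> [|k|k].
- rewrite (_ : z = fun k => iter k g (h (z k))); last by apply/funext => k; rewrite zk.
  apply: (iterates_uniform cE sg gx) => k; case: sh => _ _; exact.
- apply: contraNneq hx => zx; have := zk k; rewrite zx -{2}(iter_fixed k gx).
  have [_ gi _] := sg; have /bij_inj ginj := gi.2.
  have : injective (iter k g) by elim: (k) => //= m ih u v /ginj/ih.
  by move=> /[apply] ->.
- split; first exact: Ez.
by exists (iter k g \o h); [exact: (selfmap_iter_comp k sg sh)|exact: zk].
Qed.

Lemma eventually_avoids {R : realType} {n} {S : Type} (F : set_system S)
    {FF : Filter F} (z : S -> 'cV[R]_n) (x y : 'cV[R]_n) :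
  z @ F --> x -> (forall k, z k != x) -> \forall k \near F, z k != y.
Proof.
move=> zx nzx; have [<-|xy] := eqVneq x y; first exact: nearW.
have h : z k - y @[k --> F] --> x - y by apply: cvgB => //; exact: cvg_cst.
have xy0 : x - y != 0 by rewrite subr_eq0.
by apply: filterS (cvgr_neq0 _ h xy0) => k; rewrite subr_eq0.
Qed.

(** * Linear functionals and their orders of contact at a fixed point *)

Definition pairing {R : realType} {n} (u : 'rV[R]_n) (y : 'cV[R]_n) : R :=
  (u *m y) 0 0.

Lemma pairingE {R : realType} {n} (u : 'rV[R]_n) y :
  pairing u y = \sum_i u 0 i * y i 0.
Proof. by rewrite /pairing mxE. Qed.

Lemma pairingD {R : realType} {n} (u v : 'rV[R]_n) y :
  pairing (u + v) y = pairing u y + pairing v y.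
Proof. by rewrite /pairing mulmxDl mxE. Qed.

Lemma pairingZ {R : realType} {n} (a : R) (u : 'rV[R]_n) y :
  pairing (a *: u) y = a * pairing u y.
Proof. by rewrite /pairing -scalemxAl mxE. Qed.

Lemma pairing0 {R : realType} {n} (y : 'cV[R]_n) : pairing 0 y = 0.
Proof. by rewrite /pairing mul0mx mxE. Qed.

Lemma pairing_mul {R : realType} {n} (u : 'rV[R]_n) (T : 'M[R]_n) y :
  pairing (u *m T) y = pairing u (T *m y).
Proof. by rewrite /pairing mulmxA. Qed.

Lemma pairing_sub {R : realType} {n} (u : 'rV[R]_n) y z :
  pairing u (y - z) = pairing u y - pairing u z.
Proof. by rewrite /pairing mulmxBr !mxE. Qed.

Lemma pairing_continuous {R : realType} {n} (u : 'rV[R]_n) : continuous (pairing u).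
Proof.
move=> y; rewrite (_ : pairing u = fun z => \sum_i u 0 i * z i 0); last first.
  by apply/funext => z; rewrite pairingE.
apply: (@cvg_sumr _ _ (nbhs y)) => i; apply: cvgMl_tmp.
exact: coord_continuous.
Qed.

Lemma delta_neq0 {R : realType} {n} (i : 'I_n) : delta_mx 0 i != 0 :> 'rV[R]_n.
Proof.
by apply/eqP => /rowP /(_ i) /eqP; rewrite !mxE !eqxx oner_eq0.
Qed.

Lemma row_unit_neq0 {R : realType} {n} (P : 'M[R]_n) i :
  P \in unitmx -> row i P != 0.
Proof.
move=> Pu; apply/eqP => Pi0; have := congr1 (row i) (mulmxV Pu).
rewrite row_mul Pi0 mul0mx => /rowP /(_ i); rewrite !mxE eqxx => /esym/eqP.
exact/negP/oner_neq0.
Qed.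

Section OrderOfContact.
Context {R : realType} {S : Type} (F : set_system S) {FF : ProperFilter F}.
Context (x : S -> R) (x_to0 : x @ F --> (0 : R)) (x_neq0 : \forall k \near F, x k != 0).

Lemma lead_lower (f : S -> R) d e (m : R) :
  f k / x k ^+ e @[k --> F] --> m -> (d < e)%N ->
  f k / x k ^+ d @[k --> F] --> (0 : R).
Proof.
move=> fe de.
have h : f k / x k ^+ e * x k ^+ (e - d) @[k --> F] --> m * 0 ^+ (e - d).
  by apply: cvgM => //; exact: exprn_cvg.
rewrite expr0n subn_eq0 leqNgt de /= mulr0 in h.
apply: cvg_trans h; apply: near_eq_cvg; near=> k.
have xk : x k != 0 by near: k.
rewrite -[in x k ^+ e](subnK (ltnW de)) exprD.
by rewrite invfM [(x k ^- _) * _]mulrC mulrA mulfVK // expf_neq0.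
Unshelve. all: by end_near. Qed.

Lemma lead_unique (f : S -> R) d e (l m : R) :
  f k / x k ^+ d @[k --> F] --> l -> l != 0 ->
  f k / x k ^+ e @[k --> F] --> m -> m != 0 -> d = e /\ l = m.
Proof.
move=> fd l0 fe m0.
have [/(lead_lower fe) fd0|/(lead_lower fd) fe0|de] := ltngtP d e.
- by have := cvg_unique (@Rhausdorff R) fd fd0 => l0'; rewrite l0' eqxx in l0.
- by have := cvg_unique (@Rhausdorff R) fe fe0 => l0'; rewrite l0' eqxx in m0.
- by split=> //; rewrite de in fd; exact: cvg_unique fd fe.
Qed.

Lemma lead_gt (f : S -> R) d e (m : R) :
  f k / x k ^+ d @[k --> F] --> (0 : R) ->
  f k / x k ^+ e @[k --> F] --> m -> m != 0 -> (d < e)%N.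
Proof.
move=> fd fe m0; rewrite ltnNge; apply/negP; rewrite leq_eqVlt => /orP[/eqP ed|ed].
  by rewrite ed in fe; rewrite (cvg_unique (@Rhausdorff R) fe fd) eqxx in m0.
by rewrite (cvg_unique (@Rhausdorff R) fe (lead_lower fd ed)) eqxx in m0.
Qed.

End OrderOfContact.

Section FixedPointOrders.
Context {R : realType} {n : nat} (beta : R -> 'cV[R]_n.+1) (T : 'M[R]_n.+1).
Context {S : Type} (F : set_system S) {FF : ProperFilter F} (s s' : S -> R).
Hypothesis s0 : s @ F --> (0 : R)^'.
Hypothesis s'0 : s' @ F --> (0 : R)^'.
Hypothesis bT : \forall k \near F, beta (s' k) = T *m beta (s k).
Hypothesis Tu : T \in unitmx.
Hypothesis Tc : forall y : 'cV[R]_n.+1, y != 0 -> enorm (T *m y) < enorm y.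

(** For l != 0: the functional u vanishes to order exactly d along beta at 0, with
    leading coefficient l. For l = 0: it vanishes to a higher order. *)
Definition leading (u : 'rV[R]_n.+1) (d : nat) (l : R) : Prop :=
  pairing u (beta x) / x ^+ d @[x --> (0 : R)^'] --> l.

Hypothesis finite_order : forall u : 'rV[R]_n.+1, u != 0 ->
  exists (d : nat) (l : R), [/\ (0 < d)%N, l != 0 & leading u d l].
Hypothesis regular : exists (u : 'rV[R]_n.+1) (l : R), l != 0 /\ leading u 1 l.

Let id0 : id @ (0 : R)^' --> (0 : R). Proof. exact: nbhs_dnbhs. Qed.
Let idn : \forall x \near (0 : R)^', id x != 0. Proof. exact: nbhs_dnbhs_neq. Qed.
Let ss0 : s @ F --> (0 : R). Proof. exact: cvg_trans s0 (@nbhs_dnbhs _ _). Qed.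
Let sn : \forall k \near F, s k != 0. Proof. exact: (s0 (nbhs_dnbhs_neq (0 : R))). Qed.
Let sn' : \forall k \near F, s' k != 0. Proof. exact: (s'0 (nbhs_dnbhs_neq (0 : R))). Qed.

Lemma leadingD u v d (l m : R) : leading u d l -> leading v d m -> leading (u + v) d (l + m).
Proof.
move=> ul vm; rewrite /leading; under eq_fun do rewrite pairingD mulrDl.
exact: cvgD.
Qed.

Lemma leadingZ a u d (l : R) : leading u d l -> leading (a *: u) d (a * l).
Proof.
move=> ul; rewrite /leading; under eq_fun do rewrite pairingZ -mulrA.
exact: cvgMl_tmp.
Qed.

Lemma leading0 d : leading 0 d 0.
Proof. by rewrite /leading; under eq_fun do rewrite pairing0 mul0r; exact: cvg_cst. Qed.

Lemma leading_neq0 u d (l : R) : leading u d l -> l != 0 -> u != 0.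
Proof.
move=> Lu l0; apply: contraNneq l0 => u0; rewrite u0 in Lu.
by rewrite (cvg_unique (@Rhausdorff R) Lu (leading0 d)).
Qed.

(** Let e be the order of u1 T, where u1 is a functional of order 1. The relation
    [beta (s') = T (beta s)] gives s' ~ mu s^e along F; inserted in the leading
    term of u, this makes u T of order e d with leading coefficient mu^d l. As T
    is invertible, all orders, 1 included, are multiples of e. *)
Lemma leading_mul_exists : exists mu : R, mu != 0 /\
  forall u d l, leading u d l -> l != 0 -> leading (u *m T) d (mu ^+ d * l).
Proof.
have [u1 [l1 [l10 L1]]] := regular.
have unit_neq0 (T' : 'M[R]_n.+1) (u : 'rV[R]_n.+1) : T' \in unitmx -> u != 0 -> u *m T' != 0.
  by move=> T'u; apply: contraNneq => h; rewrite -(mulmxK T'u u) h mul0mx.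
have pull (u : 'rV[R]_n.+1) : \forall k \near F,
    pairing u (beta (s' k)) = pairing (u *m T) (beta (s k)).
  by apply: filterS bT => k ->; rewrite pairing_mul.
have along u d l : leading u d l -> pairing u (beta (s k)) / s k ^+ d @[k --> F] --> l.
  by move=> Lu; exact: cvg_trans (cvg_app _ s0) Lu.
have along' u d l : leading u d l -> pairing u (beta (s' k)) / s' k ^+ d @[k --> F] --> l.
  by move=> Lu; exact: cvg_trans (cvg_app _ s'0) Lu.
have [e [le [e0 le0 Le]]] := finite_order (unit_neq0 _ _ Tu (leading_neq0 L1 l10)).
pose mu := le / l1.
have mu0 : mu != 0 by rewrite mulf_neq0 // invr_neq0.
have smu : s' k / s k ^+ e @[k --> F] --> mu.
  have h : (pairing (u1 *m T) (beta (s k)) / s k ^+ e) /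
      (pairing u1 (beta (s' k)) / s' k ^+ 1) @[k --> F] --> mu.
    by apply: cvgM; [exact: along|apply: cvgV => //; exact: along'].
  apply: cvg_trans h; apply: near_eq_cvg; near=> k.
  have s'k : s' k != 0 by near: k.
  have sk : s k != 0 by near: k.
  have e1 : pairing u1 (beta (s' k)) = pairing (u1 *m T) (beta (s k)).
    by near: k; exact: pull.
  have e2 : pairing u1 (beta (s' k)) / s' k ^+ 1 != 0.
    by near: k; exact: cvgr_neq0 (along' _ _ _ L1) l10.
  have e3 : pairing (u1 *m T) (beta (s k)) != 0.
    by rewrite -e1; apply: contraNneq e2 => ->; rewrite mul0r.
  by rewrite e1 expr1 invf_div mulrC mulrA divfK.
have key u d l : leading u d l -> l != 0 -> leading (u *m T) (e * d) (mu ^+ d * l).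
  move=> Lu l0; have u0 := leading_neq0 Lu l0.
  have [d' [l' [d'0 l'0 Lu']]] := finite_order (unit_neq0 _ _ Tu u0).
  have h : pairing (u *m T) (beta (s k)) / s k ^+ (e * d) @[k --> F] --> mu ^+ d * l.
    have h : (s' k / s k ^+ e) ^+ d * (pairing u (beta (s' k)) / s' k ^+ d)
        @[k --> F] --> mu ^+ d * l.
      apply: cvgM; last exact: along'.
      exact: exprn_cvg smu.
    apply: cvg_trans h; apply: near_eq_cvg; near=> k.
    have s'k : s' k != 0 by near: k.
    have e1 : pairing u (beta (s' k)) = pairing (u *m T) (beta (s k)).
      by near: k; exact: pull.
    rewrite e1 exprMn exprVn -exprM mulrC mulrA mulfVK ?expf_neq0 //.
  have m0 : mu ^+ d * l != 0 by rewrite mulf_neq0 // expf_neq0.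
  have [de ml] := lead_unique ss0 sn h m0 (along _ _ _ Lu') l'0.
  by rewrite de ml.
(* the functional that T takes to u1 shows that e divides 1 *)
have e1 : e = 1%N.
  have v0 : u1 *m invmx T != 0 by apply: unit_neq0; [rewrite unitmx_inv|exact: leading_neq0 L1 l10].
  have [d [l [d0 l0 Lv]]] := finite_order v0.
  have Lv1 := key _ _ _ Lv l0; rewrite mulmxKV // in Lv1.
  have m0 : mu ^+ d * l != 0 by rewrite mulf_neq0 // expf_neq0.
  have [ed _] := lead_unique id0 idn Lv1 m0 L1 l10.
  by move/eqP: ed; rewrite muln_eq1 => /andP[/eqP].
exists mu; split=> // u d l Lu l0.
by have := key _ _ _ Lu l0; rewrite e1 mul1n.
Unshelve. all: by end_near. Qed.

Section Multiplier.
Context (mu : R).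
Hypothesis mu0 : mu != 0.
Hypothesis step : forall u d l, leading u d l -> l != 0 ->
  leading (u *m T) d (mu ^+ d * l).

Lemma leading_higher u d : leading u d 0 -> u != 0 ->
  exists e l, [/\ (d < e)%N, l != 0 & leading u e l].
Proof.
move=> Lu u0; have [e [l [e0 l0 Le]]] := finite_order u0.
by exists e, l; split=> //; exact: (lead_gt id0 idn Lu Le l0).
Qed.

Lemma leading_mul u d l : leading u d l -> leading (u *m T) d (mu ^+ d * l).
Proof.
have [->|l0 Lu] := eqVneq l 0; last exact: step.
rewrite mulr0; have [->|u0] := eqVneq u 0; first by rewrite mul0mx.
move=> Lu; have [e [m [de m0 Le]]] := leading_higher Lu u0.
exact: (lead_lower id0 idn (step Le m0) de).
Qed.

(** The derivative v of beta at 0 is an eigenvector of T of eigenvalue mu, and T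
    contracts. *)
Lemma multiplier_lt1 : `|mu| < 1.
Proof.
have coord i : exists v, leading (delta_mx 0 i) 1 v.
  have [d [l [d0 l0 Ld]]] := finite_order (delta_neq0 i).
  have [d1|d1|d1] := ltngtP 1 d; first by exists 0; exact: (lead_lower id0 idn Ld).
    by rewrite ltnNge d0 in d1.
  by exists l; move: Ld; rewrite -d1.
pose v : 'cV[R]_n.+1 := \col_i sval (cid (coord i)).
have Lv u : leading u 1 (pairing u v).
  rewrite pairingE [u in leading u]row_sum_delta.
  elim/big_ind2: _ => [|u1 l1 u2 l2|i _]; [exact: leading0|exact: leadingD|].
  by rewrite mxE; case: cid => w /= Lw; exact: leadingZ.
have Tv : T *m v = mu *: v.
  apply/colP => i.
  have := leading_mul (Lv (delta_mx 0 i)).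
  move=> /(cvg_unique (@Rhausdorff R)) /(_ (Lv _)).
  by rewrite pairing_mul expr1 /pairing -!rowE !mxE => ->.
have v0 : v != 0.
  have [u [l [l0 Lu]]] := regular.
  apply: contraNneq l0 => v0; have := cvg_unique (@Rhausdorff R) Lu (Lv u).
  by rewrite v0 /pairing mulmx0 mxE => ->.
have := Tc v0; rewrite Tv enormZ gtr_pMl // lt_neqAle sqrtr_ge0 andbT eq_sym.
rewrite sqrtr_eq0 -ltNge lt_neqAle sumr_ge0 ?andbT => [|i _]; last exact: sqr_ge0.
rewrite eq_sym psumr_neq0 => [|i _]; last exact: sqr_ge0.
have /cV0Pn [i vi] := v0; apply/hasP; exists i; rewrite ?mem_index_enum //=.
by rewrite exprn_even_gt0.
Qed.

Lemma leading_horner (p : {poly R}) u d l : leading u d l ->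
  leading (u *m horner_mx T p) d (p.[mu ^+ d] * l).
Proof.
move=> Lu; elim/poly_ind: p => [|p c ih].
  by rewrite rmorph0 mulmx0 horner0 mul0r; exact: leading0.
rewrite rmorphD rmorphM /= horner_mx_C horner_mx_X mulmxDr mulmxA.
rewrite mul_mx_scalar hornerMXaddC mulrDl.
by apply: leadingD; [rewrite mulrAC mulrC; exact: leading_mul|exact: leadingZ].
Qed.

Lemma horner_continuous (p : {poly R}) : continuous (horner p).
Proof.
elim/poly_ind: p => [|p c ih] x.
  by rewrite (_ : horner 0 = fun=> 0); [exact: cvg_cst|apply/funext => y; rewrite horner0].
rewrite (_ : horner _ = fun y => p.[y] * y + c); last first.
  by apply/funext => y; rewrite hornerMXaddC.
by apply: cvgD; [apply: cvgM; [exact: ih|exact: cvg_id]|exact: cvg_cst].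
Qed.

(** By the Cayley-Hamilton theorem, mu^d is a root of the characteristic polynomial
    for every order d that occurs; these numbers tend to 0, which is not a root. *)
Lemma orders_bounded : exists N, forall u d l, leading u d l -> l != 0 -> (d < N)%N.
Proof.
have r0 : (char_poly T).[0] != 0.
  rewrite horner_coef0 char_poly_det mulf_neq0 ?signr_eq0 //.
  by rewrite -unitfE -unitmxE.
have mud : mu ^+ d @[d --> \oo] --> (0 : R) by exact: cvg_expr multiplier_lt1.
have chi : (char_poly T).[mu ^+ d] @[d --> \oo] --> (char_poly T).[0].
  exact: continuous_cvg _ (@horner_continuous (char_poly T) 0) mud.
have [N _ hN] := cvgr_neq0 _ chi r0; exists N => u d l Lu l0.
rewrite ltnNge; apply/negP => /hN /= /negP; apply.
have := @leading_horner (char_poly T) _ _ _ Lu; rewrite Cayley_Hamilton mulmx0.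
move=> /(cvg_unique (@Rhausdorff R)) /(_ (leading0 d)) /eqP.
by rewrite mulf_eq0 (negPf l0) orbF.
Qed.

(** On functionals of order m the leading terms of u T and mu^m u cancel; on those
    of order d > m, the coefficient mu^d - mu^m is not 0. *)
Lemma mul_sub_raises (u : 'rV[R]_n.+1) m :
  (u = 0 \/ exists d l, [/\ (m <= d)%N, l != 0 & leading u d l]) ->
  let v := u *m (T - (mu ^+ m)%:M) in
  v = 0 \/ exists d l, [/\ (m < d)%N, l != 0 & leading v d l].
Proof.
move=> + v; have [v0|v0 [u0|]] := eqVneq v 0; first by left.
  by case/eqP: v0; rewrite /v u0 mul0mx.
move=> [d [l [md l0 Lu]]]; right.
have Lv : leading v d ((mu ^+ d - mu ^+ m) * l).
  have := leadingD (leading_mul Lu) (leadingZ (a := - mu ^+ m) Lu).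
  by rewrite -mulrDl /v mulmxBr mul_mx_scalar scaleNr.
have [e|md'] := eqVneq m d.
  by rewrite e subrr mul0r -e in Lv; exact: leading_higher.
exists d, ((mu ^+ d - mu ^+ m) * l); split=> //; first by rewrite ltn_neqAle md'.
rewrite mulf_neq0 // subr_eq0; apply: contraNneq md' => /(congr1 Num.norm).
rewrite !normrX => /ieexprIn -> //; first by rewrite normr_gt0.
by rewrite lt_eqF // multiplier_lt1.
Qed.

(** Each factor raises the order of every functional, beyond the bound on orders in
    the end. *)
Lemma annihilating_product : exists N,
  horner_mx T (\prod_(m <- iota 0 N) ('X - (mu ^+ m)%:P)) = 0.
Proof.
have [N hN] := orders_bounded; exists N; apply/row_matrixP => i; rewrite row0 rowE.
suff h M : let v := delta_mx 0 i *m horner_mx T (\prod_(m <- iota 0 M) ('X - (mu ^+ m)%:P)) in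
    v = 0 \/ exists d l, [/\ (M <= d)%N, l != 0 & leading v d l].
  by have [//|[d [l [Nd l0 /hN /(_ l0)]]]] := h N; rewrite ltnNge Nd.
elim: M => [|M ih] v.
  have [|v0] := eqVneq v 0; [by left|right].
  by have [d [l [d0 l0 Lv]]] := finite_order v0; exists d, l.
suff -> : v = delta_mx 0 i *m horner_mx T (\prod_(m <- iota 0 M) ('X - (mu ^+ m)%:P))
    *m (T - (mu ^+ M)%:M) by exact: mul_sub_raises.
rewrite /v -[in iota 0 _](addn1 M) iotaD big_cat big_seq1 /= add0n rmorphM /=.
by rewrite -mulmxA rmorphB /= horner_mx_C horner_mx_X.
Qed.

(** T is annihilated by a product of distinct linear factors, hence diagonalizable;
    the eigenvalue of an eigenfunctional is given by its order. Two independent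
    eigenfunctionals of the same order d would have a combination of order e > d,
    whose eigenvalue would be both mu^d and mu^e. *)
Lemma eigenbasis_of_orders : exists (P : 'M[R]_n.+1) (d : 'I_n.+1 -> nat),
  [/\ P \in unitmx, injective d, forall i, (0 < d i)%N, exists i, d i = 1%N &
    forall i, row i P *m T = mu ^+ d i *: row i P /\
      exists2 l : R, l != 0 & leading (row i P) (d i) l].
Proof.
have mu1 := multiplier_lt1.
have inj_mu : injective (GRing.exp mu).
  move=> i j /(congr1 Num.norm); rewrite !normrX; apply: ieexprIn.
    by rewrite normr_gt0.
  by rewrite lt_eqF.
have [N hN] := annihilating_product.
have /diagonalizableP [P Pu /diagonalizable_forPex [D /(simmxP Pu) PT]] :
    exists2 rs, uniq rs & mxminpoly T %| \prod_(x <- rs) ('X - x%:P).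
  exists [seq mu ^+ m | m <- iota 0 N]; first by rewrite map_inj_uniq ?iota_uniq.
  by rewrite big_map; exact: mxminpoly_min.
have PTi i : row i P *m T = D 0 i *: row i P.
  by rewrite -row_mul PT mul_diag_mx; apply/rowP => j; rewrite !mxE.
have P0 i : row i P != 0 := row_unit_neq0 i Pu.
pose d i := sval (cid (finite_order (P0 i))).
have dP i : exists l, [/\ (0 < d i)%N, l != 0 & leading (row i P) (d i) l].
  exact: svalP (cid (finite_order (P0 i))).
have muD i : D 0 i = mu ^+ d i.
  have [l [d0 l0 Li]] := dP i.
  have := leading_mul Li; rewrite PTi.
  move=> /(cvg_unique (@Rhausdorff R)) /(_ (leadingZ Li)).
  by move/(mulIf l0).
have dinj : injective d.
  move=> i j dij; apply/eqP/negP => /negP ij.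
  have [l [d0 l0 Li]] := dP i; have [m [_ m0]] := dP j; rewrite -dij => Lj.
  pose w := m *: row i P - l *: row j P.
  have Lw : leading w (d i) 0.
    have := leadingD (leadingZ (a := m) Li) (leadingZ (a := - l) Lj).
    by rewrite mulNr mulrC subrr scaleNr.
  have w0 : w != 0.
    have wE : w = (m *: delta_mx 0 i - l *: delta_mx 0 j) *m P.
      by rewrite mulmxBl -!scalemxAl -!rowE.
    rewrite wE; apply/eqP => /(congr1 (mulmx^~ (invmx P))).
    rewrite mul0mx mulmxK // => /matrixP /(_ 0 i).
    rewrite !mxE !eqxx (negPf ij) mulr0 subr0 mulr1 => /eqP.
    exact/negP.
  have [e [k [de k0 Le]]] := leading_higher Lw w0.
  have wT : w *m T = mu ^+ d i *: w.
    rewrite mulmxBl -!scalemxAl !PTi !muD -dij scalerBr !scalerA.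
    by rewrite (mulrC m) (mulrC l).
  have := leading_mul Le; rewrite wT.
  move=> /(cvg_unique (@Rhausdorff R)) /(_ (leadingZ Le)).
  by move/(mulIf k0)/inj_mu => ed; rewrite ed ltnn in de.
have d1 : exists i, d i = 1%N.
  apply: contrapT => no1; have [u [l [l0 Lu]]] := regular.
  suff Lu0 : leading u 1 0.
    by have := cvg_unique (@Rhausdorff R) Lu Lu0 => l0'; rewrite l0' eqxx in l0.
  rewrite -(mulmxKV Pu u) mulmx_sum_row.
  have L1 i : leading (row i P) 1 0.
    have [m [d0 _ Li]] := dP i; apply: (lead_lower id0 idn Li).
    by rewrite ltn_neqAle d0 andbT eq_sym; apply/eqP => di; apply: no1; exists i.
  elim/big_ind: _ => [|v w Lv Lw|i _]; first exact: leading0.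
    by have := leadingD Lv Lw; rewrite addr0.
  by have := leadingZ (a := (u *m invmx P) 0 i) (L1 i); rewrite mulr0.
exists P, d; split=> // i; first by have [l []] := dP i.
by rewrite PTi muD; split=> //; have [l [_ l0 Ll]] := dP i; exists l.
Qed.

End Multiplier.
End FixedPointOrders.

(** * Affine self-maps of a monomial curve *)

Lemma poly_infinite_roots {R : idomainType} (p : {poly R}) (s : nat -> R) :
  injective s -> (forall k, root p (s k)) -> p = 0.
Proof.
move=> sinj rs; apply/eqP/negP => /negP p0.
have := @max_poly_roots _ p [seq s k | k <- iota 0 (size p)] p0.
rewrite size_map size_iota ltnn map_inj_uniq // iota_uniq => h.
have /h : all (root p) [seq s k | k <- iota 0 (size p)].
  by apply/allP => _ /mapP [k _ ->].
by move=> /(_ isT).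
Qed.

Section Exponents.
Context {F : numFieldType} {n : nat} (d : 'I_n.+1 -> nat) (i0 : 'I_n.+1).
Hypotheses (dinj : injective d) (dpos : forall i, (0 < d i)%N).
Context (A : 'M[F]_n.+1) (v : 'cV[F]_n.+1).
Hypotheses (A_unit : A \in unitmx) (v_neq0 : v != 0).

(** The j-th coordinate of the map x -> A x + v along the curve s -> (s^(d k))_k. *)
Definition affine_poly (j : 'I_n.+1) : {poly F} :=
  \sum_k A j k *: 'X^(d k) + (v j 0)%:P.

Lemma coef_affine_poly j m :
  (affine_poly j)`_m = \sum_k A j k * (m == d k)%:R + v j 0 * (m == 0)%:R.
Proof.
rewrite /affine_poly coefD coef_sum coefC; congr (_ + _).
  by apply: eq_bigr => k _; rewrite coefZ coefXn.
by case: eqP => _; rewrite ?mulr1 ?mulr0.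
Qed.

Lemma coef_affine_poly_exponent j k : (affine_poly j)`_(d k) = A j k.
Proof.
rewrite coef_affine_poly (bigD1 k) //= eqxx mulr1 big1 => [|i ik].
  by rewrite gtn_eqF ?dpos // mulr0 !addr0.
by rewrite (inj_eq dinj) eq_sym (negPf ik) mulr0.
Qed.

Lemma coef_affine_poly0 j : (affine_poly j)`_0 = v j 0.
Proof.
rewrite coef_affine_poly eqxx mulr1 big1 ?add0r // => k _.
by rewrite ltn_eqF ?dpos // mulr0.
Qed.

Lemma linear_pow_coef (la mu : F) D m : (m <= D)%N ->
  ((la *: 'X + mu%:P) ^+ D)`_m = la ^+ m * mu ^+ (D - m) *+ 'C(D, m).
Proof.
move=> mD; rewrite addrC exprDn coef_sum.
have termE (i : 'I_D.+1) : (mu%:P ^+ (D - i) * (la *: 'X) ^+ i *+ 'C(D, i))`_m =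
    la ^+ m * mu ^+ (D - m) *+ 'C(D, m) * (m == i)%:R.
  rewrite coefMn exprZn -rmorphXn /= coefCM coefZ coefXn.
  by case: eqP => [<-|_]; rewrite ?mulr1 ?mulr0 ?mul0rn // mulrC.
rewrite (eq_bigr _ (fun i _ => termE i)).
have mD1 : (m < D.+1)%N by [].
rewrite (bigD1 (Ordinal mD1)) //= eqxx mulr1 big1 ?addr0 // => i im.
by rewrite (_ : m == i = false) ?mulr0 //; apply: contraNF im => /eqP e; apply/eqP/val_inj.
Qed.

Definition monomial_curve (x : F) : 'cV[F]_n.+1 := \col_i x ^+ d i.

Lemma affine_polyE j x : (affine_poly j).[x] = (A *m monomial_curve x + v) j 0.
Proof.
rewrite /affine_poly hornerD hornerC horner_sum !mxE; congr (_ + _).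
by apply: eq_bigr => k _; rewrite hornerZ hornerXn mxE.
Qed.

Lemma size_affine_poly D j : (forall i, (d i <= D)%N) -> (size (affine_poly j) <= D.+1)%N.
Proof.
move=> dD; apply/leq_sizeP => m Dm; rewrite coef_affine_poly.
rewrite gtn_eqF ?(leq_trans _ Dm) // mulr0 addr0 big1 // => k _.
by rewrite gtn_eqF ?mulr0 // (leq_ltn_trans (dD k)).
Qed.

(** The polynomials Q_j of the coordinates satisfy Q_j = phi ^ d_j with phi = Q_i0,
    since they do at infinitely many points. As all Q_j have degree at most
    D = max d_j, phi = la X + mu. Here la != 0 because A is invertible, and mu != 0
    because otherwise all Q_j, and v with them, would vanish at 0. Now all
    monomials occur in phi ^ D, while the exponents that occur in Q_j are 0 and the
    d_k: the d_k exhaust 1, .., D. *)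
Lemma exponents_consecutive (s : nat -> F) : injective s ->
  (forall k j, (A *m monomial_curve (s k) + v) j 0 =
     (A *m monomial_curve (s k) + v) i0 0 ^+ d j) ->
  forall j, (d j <= n.+1)%N.
Proof.
move=> sinj inv; pose Q := affine_poly; pose phi := Q i0.
have Qphi j : Q j = phi ^+ d j.
  apply/eqP; rewrite -subr_eq0; apply/eqP.
  apply: (poly_infinite_roots sinj) => k.
  by rewrite /root hornerD hornerN horner_exp !affine_polyE inv subrr.
have [jm dmax] : exists jm, forall j, (d j <= d jm)%N.
  have [jm _ dm] := @arg_maxnP _ i0 xpredT d isT.
  by exists jm => j; exact: dm.
pose D := d jm; have D0 : (0 < D)%N by exact: dpos.
have size_phi : (size phi <= 2)%N.
  have := size_affine_poly jm dmax; rewrite -/(Q jm) Qphi => sD.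
  have : (((size phi).-1 * D) <= D)%N.
    by rewrite -size_exp -subn1 leq_subLR add1n.
  rewrite -{2}(mul1n D) leq_pmul2r //.
  by case: (size phi).
pose la := phi`_1; pose mu := phi`_0.
have phiE : phi = la *: 'X + mu%:P.
  apply/polyP => -[|[|m]]; rewrite [RHS]coefD coefZ coefX coefC /= ?mulr0 ?mulr1 ?add0r ?addr0 //.
  by rewrite nth_default // (leq_trans size_phi).
have la0 : la != 0.
  apply: contraTneq A_unit => la0.
  suff -> : A = 0 by rewrite unitmxE det0 unitr0.
  apply/matrixP => j k; rewrite mxE -coef_affine_poly_exponent -/(Q j) Qphi phiE la0.
  by rewrite scale0r add0r -rmorphXn /= coefC gtn_eqF.
have mu0 : mu != 0.
  apply: contraNneq v_neq0 => mu0; apply/eqP/colP => j.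
  rewrite mxE -coef_affine_poly0 -/(Q j) Qphi phiE mu0 addr0.
  by rewrite exprZn coefZ coefXn ltn_eqF ?mulr0.
have hit m : (0 < m <= D)%N -> exists k, d k = m.
  move=> /andP[m0 mD]; apply: contrapT => /forallNP nk.
  have : (Q jm)`_m != 0.
    rewrite Qphi phiE linear_pow_coef // mulrn_eq0 negb_or -lt0n bin_gt0 mD.
    by rewrite mulf_neq0 // expf_neq0.
  rewrite coef_affine_poly gtn_eqF // mulr0 addr0 big1 ?eqxx // => k _.
  by have /eqP := nk k; rewrite eq_sym => /negPf ->; rewrite mulr0.
move=> j; apply: leq_trans (dmax j) _; rewrite -/D.
have hit' (m : 'I_D) : exists k, d k = m.+1 by apply: hit; rewrite /= ltn_ord.
pose h m := sval (cid (hit' m)).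
have hinj : injective h.
  move=> m m' e; apply/val_inj/succn_inj => /=.
  by rewrite -(svalP (cid (hit' m))) -(svalP (cid (hit' m'))) -/(h m) e.
by have := leq_card h hinj; rewrite !card_ord.
Qed.
End Exponents.

(** * Auxiliary facts on intervals and on orbits of affine maps *)

Lemma continuous_zero_itv {R : realType} (h : R -> R) (a b : R) :
  a < b -> continuous h -> (forall t, t \in `]a, b[ -> h t = 0) ->
  forall t, t \in `[a, b] -> h t = 0.
Proof.
move=> ab ch h0 t; rewrite in_itv /= => /andP[a_t tb].
have [e|at'] := eqVneq a t.
  have : h s @[s --> a^'+] --> h a by apply: cvg_trans (ch a); exact/cvg_app/cvg_within.
  rewrite -e => ha; apply: (cvg_unique (@Rhausdorff R) ha).
  apply: cvg_near_cst; near=> s.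
  by rewrite h0 // in_itv /=; apply/andP; split; near: s;
    [exact: nbhs_right_gt|exact: nbhs_right_lt].
have [e|bt'] := eqVneq b t.
  have : h s @[s --> b^'-] --> h b by apply: cvg_trans (ch b); exact/cvg_app/cvg_within.
  rewrite -e => ha; apply: (cvg_unique (@Rhausdorff R) ha).
  apply: cvg_near_cst; near=> s.
  by rewrite h0 // in_itv /=; apply/andP; split; near: s;
    [exact: nbhs_left_gt|exact: nbhs_left_lt].
by apply: h0; rewrite in_itv /= !lt_neqAle at' a_t tb eq_sym bt'.
Unshelve. all: by end_near. Qed.

Lemma continuous_image_itv {R : realType} (f : R -> R) (a b : R) :
  a <= b -> continuous f -> exists c e, c <= e /\ f @` `[a, b] = [set` `[c, e]].
Proof.
move=> ab cf; have cw A : {within A, continuous f} by exact: continuous_subspaceT.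
have [tm tmab hm] := EVT_min ab (cw _); have [tM tMab hM] := EVT_max ab (cw _).
exists (f tm), (f tM); split; first exact: hm.
have ivt u w y : u <= w -> u \in `[a, b] -> w \in `[a, b] ->
    Num.min (f u) (f w) <= y <= Num.max (f u) (f w) -> exists2 t, t \in `[a, b] & f t = y.
  move=> uw uab wab hy; have [t tuw ft] := IVT uw (cw _) hy; exists t => //.
  move: tuw uab wab; rewrite !in_itv /= => /andP[ut tw] /andP[au _] /andP[_ wb].
  by rewrite (le_trans au ut) (le_trans tw wb).
apply/seteqP; split=> [_ [t tab <-]|y].
  by rewrite /= in_itv /= hm // hM.
rewrite /= in_itv /= => hy.
suff [t tab <-] : exists2 t, t \in `[a, b] & f t = y by exists t.
have mM : f tm <= f tM by exact: hm.
have [le|/ltW le] := leP tm tM.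
  by apply: (ivt tm tM) => //; rewrite min_l // max_r.
by apply: (ivt tM tm) => //; rewrite min_r // max_l.
Qed.

Lemma iter_affine {R : realType} {n} (g : 'cV[R]_n.+1 -> 'cV[R]_n.+1) (T : 'M[R]_n.+1) v p q k :
  (forall x, g x = T *m x + v) -> g p = p ->
  iter k g q - p = (T ^+ k) *m (q - p).
Proof.
move=> gE gp; elim: k => [|k ih]; first by rewrite expr0 mul1mx.
rewrite iterS exprS -mulmxE -mulmxA -ih mulmxBr.
by rewrite -[in LHS]gp !gE opprD addrACA subrr addr0.
Qed.

Lemma pairing_eigen {R : realType} {n} (w : 'rV[R]_n.+1) (M : 'M[R]_n.+1) (c : R) m y :
  w *m M = c *: w -> pairing w ((M ^+ m) *m y) = c ^+ m * pairing w y.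
Proof.
move=> wM; rewrite -pairing_mul; elim: m => [|m ih]; first by rewrite !expr0 mulmx1 mul1r.
by rewrite exprS -mulmxE mulmxA wM -scalemxAl pairingZ ih exprS mulrA.
Qed.

(** * Analytic curves containing a self-affine set *)

Section Curve.
Context {R : realType} {n : nat} (a b : R) (gamma : R -> 'cV[R]_n.+1).
Hypothesis ab : a < b.
Hypothesis cgamma : continuous gamma.
Hypothesis gamma_analytic : forall i t, t \in `]a, b[ ->
  real_analytic_at (fun s => gamma s i 0) t.
Hypothesis gamma_spans : forall (u : 'rV[R]_n.+1) c, u != 0 ->
  ~ (forall t, t \in `[a, b] -> pairing u (gamma t) = c).

Lemma pairing_analytic u c t : t \in `]a, b[ ->
  real_analytic_at (fun s => pairing u (gamma s) - c) t.
Proof.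
move=> tab; apply: analyticD; last exact: analytic_cst.
under [X in real_analytic_at X _]eq_fun do rewrite pairingE.
by apply: analytic_sum => i; apply: analyticZ; exact: gamma_analytic.
Qed.

Lemma pairing_not_locally_constant u c t : u != 0 -> t \in `]a, b[ ->
  ~ \forall s \near t, pairing u (gamma s) - c = 0.
Proof.
move=> u0 tab cst; apply: (@gamma_spans u c u0) => s sab.
apply/eqP; rewrite -subr_eq0; apply/eqP; move: s sab.
apply: (@continuous_zero_itv _ (fun s => pairing u (gamma s) - c) _ _ ab).
  move=> s; apply: cvgB; last exact: cvg_cst.
  exact: (cvg_comp _ _ (@cgamma s) (@pairing_continuous _ _ u _)).
apply: (@identity_principle _ (fun s => pairing u (gamma s) - c) _ _ _ _ tab).
  by move=> *; exact: pairing_analytic.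
move=> nz; have nzc : \forall s \near t^',
    pairing u (gamma s) - c != 0 /\ pairing u (gamma s) - c = 0.
  by apply: filterI => //; exact: nbhs_dnbhs.
have pf : ProperFilter t^' by exact: Proper_dnbhs_numFieldType.
by have [x [nzx zx]] := @filter_ex _ _ pf _ nzc; rewrite zx eqxx in nzx.
Qed.

Lemma isolated_preimages p t : t \in `]a, b[ -> \forall s \near t^', gamma s != p.
Proof.
move=> tab; pose u : 'rV[R]_n.+1 := delta_mx 0 0.
have u0 : u != 0 := delta_neq0 0.
have [/(pairing_not_locally_constant u0 tab)//|] :=
  analytic_zeros_isolated (pairing_analytic u (pairing u p) tab).
by apply: filterS => s; apply: contraNneq => ->; rewrite subrr.
Qed.

Definition regular_at t : Prop := exists (u : 'rV[R]_n.+1) (l : R), l != 0 /\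
  pairing u (gamma (t + x) - gamma t) / x ^+ 1 @[x --> (0 : R)^'] --> l.

Lemma regular_near t : t \in `]a, b[ -> \forall s \near t^', regular_at s.
Proof.
move=> tab; pose u : 'rV[R]_n.+1 := delta_mx 0 0.
have u0 : u != 0 := delta_neq0 0.
have [cst|] := analytic_regular_near (pairing_analytic u 0 tab).
  exfalso; apply: (@pairing_not_locally_constant u (pairing u (gamma t)) t u0 tab).
  by apply: filterS cst => s; rewrite !subr0 => ->; rewrite subrr.
apply: filterS => s [l l0 hl]; exists u, l; split=> //.
apply: cvg_trans hl; apply: near_eq_cvg; apply: nearW => x.
by rewrite pairing_sub !subr0 expr1.
Qed.

Lemma finite_order_at u t : u != 0 -> t \in `]a, b[ -> exists d (l : R),
  [/\ (0 < d)%N, l != 0 &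
    pairing u (gamma (t + x) - gamma t) / x ^+ d @[x --> (0 : R)^'] --> l].
Proof.
move=> u0 tab.
have [cst|[d [l [l0 hl]]]] := analytic_increment (pairing_analytic u 0 tab).
  exfalso; apply: (@pairing_not_locally_constant u (pairing u (gamma t)) t u0 tab).
  by apply: filterS cst => s; rewrite !subr0 => ->; rewrite subrr.
exists d.+1, l; split=> //.
apply: cvg_trans hl; apply: near_eq_cvg; apply: nearW => x.
by rewrite pairing_sub !subr0.
Qed.


(** Two rounds of accumulation. Fixed points accumulate at a fixed point x0, so one
    of them, x1, avoids both end points of the curve. Fixed points y_k accumulate
    at x1 in turn; the parameters of y_k approach those of x1 without being equal
    to them, and singular parameters are isolated. *)
Lemma regular_fixed_point (E : set 'cV[R]_n.+1) :
  E !=set0 -> compact E -> (forall p, exists2 g, selfmap E g & g p != p) ->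
  exists g p, [/\ selfmap E g, E p, g p = p &
    forall t, t \in `[a, b] -> gamma t = p -> (t \in `]a, b[) /\ regular_at t].
Proof.
move=> E0 cE mv; have [g0 sg0 _] := mv 0.
have [x0 _ gx0] := selfmap_fixed E0 cE sg0.
have [h0 sh0 hx0] := mv x0.
have [z [zx0 nzx0 zfix]] := nearby_fixed_points E0 cE sg0 sh0 gx0 hx0.
have /filter_ex [k [zka zkb]] : \forall k \near \oo, z k != gamma a /\ z k != gamma b.
  by apply: filterI; apply: eventually_avoids zx0 nzx0.
have [_ [g1 sg1 gx1]] := zfix k.
set x1 := z k in zka zkb gx1.
have [h1 sh1 hx1] := mv x1.
have [y [yx1 nyx1 yfix]] := nearby_fixed_points E0 cE sg1 sh1 gx1 hx1.
suff : \forall k \near \oo, [set t | t \in `[a, b]] `<=` (fun t =>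
    gamma t = y k -> (t \in `]a, b[) /\ regular_at t).
  move=> /filter_ex [m hm]; have [Ey [g sg gy]] := yfix m.
  by exists g, (y m); split=> // t tab; exact: hm.
have /compact_near_coveringP := @segment_compact _ a b; apply=> t tab.
have [gt|gt] := eqVneq (gamma t) x1; last first.
  have h : gamma p.1 - y p.2 @[p --> (nbhs t, \oo)] --> gamma t - x1.
    apply: cvgB.
      by apply: (cvg_comp (fun p : R * nat => p.1) gamma); [exact: cvg_fst|exact: cgamma].
    by apply: (cvg_comp (fun p : R * nat => p.2) y); [exact: cvg_snd|exact: yx1].
  have gt0 : gamma t - x1 != 0 by rewrite subr_eq0.
  by apply: filterS (cvgr_neq0 _ h gt0) => -[s m] /=; rewrite subr_eq0 => /eqP.
have tab' : t \in `]a, b[.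
  move: tab; rewrite /= !in_itv /= => /andP[a_t tb].
  rewrite !lt_neqAle a_t tb !andbT; apply/andP; split.
    by apply: contraNneq zka => ->; rewrite gt.
  by apply: contraNneq zkb => <-; rewrite gt.
near=> s m => /= gs; split; first by near: s; exact: near_in_itvoo.
have st : s != t by apply: contraNneq (nyx1 m) => st; rewrite -gs st gt.
have : s != t -> regular_at s by near: s; exact: (regular_near tab').
exact.
Unshelve. all: by end_near. Qed.


(** Along an ultrafilter U the j-th shift of the sequence converges to a parameter
    tau_j of p, for each j. Since the parameters of p are isolated, tau itself is
    equal to its limit t0 along U at U-many indices, hence at two of them. *)
Lemma recurrent_parameter p (s : nat -> R) :
  (forall t, t \in `[a, b] -> gamma t = p -> t \in `]a, b[) ->
  (forall k, s k \in `[a, b]) -> gamma (s k) @[k --> \oo] --> p ->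
  exists (U : set_system nat) (t0 : R) (i j : nat),
    [/\ UltraFilter U, gamma t0 = p, t0 \in `[a, b], (i < j)%N &
      s (k + i)%N @[k --> U] --> t0 /\ s (k + j)%N @[k --> U] --> t0].
Proof.
move=> pint sab gsp; have [U UU Uoo] := ultra_extends_oo.
have cab : compact [set t | t \in `[a, b]] := @segment_compact _ a b.
have tauP j : exists2 t, t \in `[a, b] & s (k + j)%N @[k --> U] --> t.
  by apply: (ultra_compact_cvg cab); apply: nearW => k; exact: sab.
pose tau j := s2val (cid2 (tauP j)).
have tau_ab j : tau j \in `[a, b] := s2valP (cid2 (tauP j)).
have tau_lim j : s (k + j)%N @[k --> U] --> tau j := s2valP' (cid2 (tauP j)).
have gtau j : gamma (tau j) = p.
  apply: (@cvg_unique _ (@norm_hausdorff _ _) (gamma (s (k + j)%N) @[k --> U])).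
    exact: (cvg_comp (fun k => s (k + j)%N) gamma (tau_lim j) (@cgamma _)).
  apply: cvg_trans (cvg_app _ Uoo) _.
  by rewrite (cvg_shiftn j (fun k => gamma (s k))).
have [t0 t0ab taut0] : exists2 t0, t0 \in `[a, b] & tau @ U --> t0.
  by apply: (ultra_compact_cvg cab); apply: nearW => k; exact: tau_ab.
have gt0 : gamma t0 = p.
  apply: (@cvg_unique _ (@norm_hausdorff _ _) (gamma (tau k) @[k --> U])).
    exact: (cvg_comp tau gamma taut0 (@cgamma _)).
  by apply: cvg_near_cst; exact: nearW.
have tau_eq : \forall j \near U, tau j = t0.
  have iso : \forall t \near t0, t != t0 -> gamma t != p.
    exact: isolated_preimages (pint _ t0ab gt0).
  have h : \forall j \near U, tau j != t0 -> gamma (tau j) != p by exact: taut0 _ iso.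
  by apply: filterS h => j h; apply/eqP/negP => /negP /h; rewrite gtau eqxx.
have [i ti] : exists i, tau i = t0 by apply: filter_ex tau_eq.
have [j [tj ij]] : exists j, tau j = t0 /\ (i < j)%N.
  have ioo : \forall j \near U, (i < j)%N by apply: Uoo; exact: nbhs_infty_gt.
  have /filter_ex : \forall j \near U, tau j = t0 /\ (i < j)%N by exact: filterI.
  by [].
exists U, t0, i, j; split=> //.
by split; [rewrite -ti|rewrite -tj]; exact: tau_lim.
Qed.

(** With L = j - i, the point of index k + i of the orbit is obtained by applying
    [g^L] (k + i) / L times to one of the first L points, which does not depend on
    k once the residue of k + i modulo L is fixed. In the eigencoordinates w_r
    of [T^L] both w_r and a power of w_i0 are then geometric sequences of the
    same ratio, hence proportional. The relation extends to the curve by the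
    identity principle. *)
Lemma monomial_coordinates (E : set 'cV[R]_n.+1) :
  E !=set0 -> compact E -> (forall p, exists2 g, selfmap E g & g p != p) ->
  E `<=` gamma @` `[a, b] ->
  exists (p : 'cV[R]_n.+1) (Q : 'M[R]_n.+1) (d : 'I_n.+1 -> nat) (i0 : 'I_n.+1),
    [/\ Q \in unitmx, injective d, forall i, (0 < d i)%N, d i0 = 1%N &
      forall t, t \in `[a, b] -> forall i,
        (Q *m (gamma t - p)) i 0 = (Q *m (gamma t - p)) i0 0 ^+ d i].
Proof.
move=> E0 cE mv EK.
have [g [p [sg Ep gp reg]]] :=
  regular_fixed_point E0 cE mv.
have [gc ginv gE] := sg.
have [T [v [Tu gT]]] := affine_linear_part ginv.
have [q Eq qp] : exists2 q, E q & q != p.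
  by have [g' [_ _ g'E] g'p] := mv p; exists (g' p) => //; exact: g'E.
have Eqk k : E (iter k g q) by elim: k => //= k; exact: gE.
have qk k : iter k g q != p := orbit_neq k (bij_inj ginv.2) gp qp.
pose s k := s2val (cid2 (EK _ (Eqk k))).
have sab k : s k \in `[a, b] := s2valP (cid2 (EK _ (Eqk k))).
have gs k : gamma (s k) = iter k g q := s2valP' (cid2 (EK _ (Eqk k))).
have gsp : gamma (s k) @[k --> \oo] --> p.
  rewrite (_ : (fun k => _) = fun k => iter k g q); last by apply/funext.
  exact: (iterates_uniform cE sg gp).
have pint t : t \in `[a, b] -> gamma t = p -> t \in `]a, b[.
  by move=> tab gt; have [] := reg t tab gt.
have [U [t0 [i [j [UU gt0 t0ab ij [si sj]]]]]] :=
  recurrent_parameter pint sab gsp.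
have [t0int t0reg] := reg _ t0ab gt0.
pose beta x := gamma (t0 + x) - p.
pose L := (j - i)%N; have L0 : (0 < L)%N by rewrite subn_gt0.
have s_lim k : s (m + k)%N @[m --> U] --> t0 -> s (m + k)%N - t0 @[m --> U] --> (0 : R)^'.
  move=> h A A0.
  have h' : s (m + k)%N - t0 @[m --> U] --> (0 : R).
    by rewrite -(subrr t0); apply: cvgB => //; exact: cvg_cst.
  have {}h' : \forall m \near U, s (m + k)%N - t0 != 0 -> A (s (m + k)%N - t0) by exact: h' _ A0.
  apply: filterS h' => m; apply; rewrite subr_eq0.
  by apply: contraNneq (qk (m + k)%N) => e; rewrite -gs e gt0.
have betaE m : beta (s m - t0) = (T ^+ m) *m (q - p).
  by rewrite /beta subrKC gs (iter_affine _ _ gT gp).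
have bT : \forall k \near U, beta (s (k + j)%N - t0) = (T ^+ L) *m beta (s (k + i)%N - t0).
  apply: nearW => k; rewrite !betaE mulmxA mulmxE -exprD /L.
  by rewrite addnCA subnK // ltnW.
have Tc y : y != 0 -> enorm ((T ^+ L) *m y) < enorm y.
  move=> y0; have {2}-> : y = (p + y) - p by rewrite addrAC subrr add0r.
  have <- : iter L g (p + y) - p = (T ^+ L) *m y.
    by rewrite (iter_affine _ _ gT gp) addrAC subrr add0r.
  have pyp : p + y != p by rewrite -subr_eq0 addrAC subrr add0r.
  by rewrite -(prednK L0); exact: iter_closer.
have TLu : T ^+ L \in unitmx by apply: unitrX.
have fo u : u != 0 -> exists (d : nat) (l : R), [/\ (0 < d)%N, l != 0 & leading beta u d l].
  move=> u0; have := finite_order_at u0 t0int.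
  by rewrite gt0.
have ro : exists (u : 'rV[R]_n.+1) (l : R), l != 0 /\ leading beta u 1 l.
  by move: t0reg; rewrite /regular_at gt0.
have [mu [mu0 step]] := leading_mul_exists (s_lim i si) (s_lim j sj) bT TLu fo ro.
have [P [d [Pu dinj d0 [i0 di0] eig]]] := eigenbasis_of_orders TLu Tc fo ro mu0 step.
pose w r := row r P.
pose x k := s (k + i)%N - t0.
have w_neq0 r : \forall k \near U, pairing (w r) (beta (x k)) != 0.
  have [_ [l l0 lr]] := eig r.
  have h : pairing (w r) (beta (x k)) / x k ^+ d r @[k --> U] --> l.
    exact: cvg_trans (cvg_app _ (s_lim i si)) lr.
  apply: filterS (cvgr_neq0 _ h l0) => k.
  by apply: contraNneq => ->; rewrite mul0r.
(* an ultrafilter selects one residue class *)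
have [rho hrho] : exists rho, \forall k \near U, ((k + i) %% L)%N = rho.
  apply: contrapT => /forallNP nrho.
  have : \forall k \near U, forall r : 'I_L, ((k + i) %% L)%N <> r.
    apply: filter_forall => r.
    have [h|//] := in_ultra_setVsetC [set k | ((k + i) %% L)%N = r] UU.
    by case: (nrho r).
  by move=> /filter_ex [k /(_ (Ordinal (ltn_pmod (k + i) L0)))].
pose c r := pairing (w r) ((T ^+ rho) *m (q - p)).
have wE r : \forall k \near U,
    pairing (w r) (beta (x k)) = (mu ^+ d r) ^+ ((k + i) %/ L) * c r.
  apply: filterS hrho => k hk.
  rewrite betaE {1}(divn_eq (k + i) L) hk exprD mulnC exprM -mulmxE -mulmxA.
  by apply: pairing_eigen; have [] := eig r.
have c_neq0 r : c r != 0.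
  have : \forall k \near U, pairing (w r) (beta (x k)) != 0 /\
      pairing (w r) (beta (x k)) = (mu ^+ d r) ^+ ((k + i) %/ L) * c r.
    by apply: filterI; [exact: w_neq0|exact: wE].
  move=> /filter_ex [k [+ e]]; rewrite e.
  by apply: contraNneq => ->; rewrite mulr0.
pose C r := c r / c i0 ^+ d r.
have C_neq0 r : C r != 0 by rewrite mulf_neq0 // invr_neq0 // expf_neq0.
have on_curve r t : t \in `[a, b] ->
    pairing (w r) (gamma t - p) - C r * pairing (w i0) (gamma t - p) ^+ d r = 0.
  move: t; apply: (@continuous_zero_itv _ (fun t => pairing (w r) (gamma t - p) -
    C r * pairing (w i0) (gamma t - p) ^+ d r) _ _ ab).
    have cw u : continuous (fun t => pairing u (gamma t - p)).
      move=> t; apply: (cvg_comp (fun t => gamma t - p) (pairing u)).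
        by apply: cvgB; [exact: cgamma|exact: cvg_cst].
      exact: pairing_continuous.
    move=> t; apply: cvgB; first exact: cw.
    have h : pairing (w i0) (gamma u - p) ^+ d r @[u --> t] --> pairing (w i0) (gamma t - p) ^+ d r.
      by apply: exprn_cvg; exact: cw.
    exact: cvgMl_tmp h.
  apply: (@identity_principle _ (fun t => pairing (w r) (gamma t - p) -
    C r * pairing (w i0) (gamma t - p) ^+ d r) a b t0) => //.
    have aw u t : t \in `]a, b[ -> real_analytic_at (fun t => pairing u (gamma t - p)) t.
      move=> tab; under [X in real_analytic_at X _]eq_fun do rewrite pairing_sub.
      exact: pairing_analytic.
    move=> t tab; apply: analyticD; first exact: aw.
    under [X in real_analytic_at X _]eq_fun do rewrite -mulNr.
    by apply: analyticZ; apply: analyticX; exact: aw.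
  move=> nz.
  have : \forall k \near U, pairing (w r) (beta (x k)) -
      C r * pairing (w i0) (beta (x k)) ^+ d r != 0.
    have h := (dnbhs0P _ _).2 nz; exact: (s_lim i si _ h).
  move=> /filterI /(_ (filterI (wE r) (wE i0))) /filter_ex [k [nk [e1 e2]]].
  move: nk; rewrite e1 e2 di0 expr1 /C exprMn -!exprM mulnC mulrCA.
  by rewrite divfK ?subrr ?eqxx // expf_neq0.
(* rescaling the eigencoordinates turns all constants into 1 *)
exists p, (diag_mx (\row_r (C r)^-1) *m P), d, i0; split=> //.
  rewrite unitmx_mul Pu andbT unitmxE det_diag unitfE.
  by apply/prodf_neq0 => r _; rewrite mxE invr_neq0.
have QE t r : ((diag_mx (\row_r (C r)^-1) *m P) *m (gamma t - p)) r 0 =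
    (C r)^-1 * pairing (w r) (gamma t - p).
  rewrite -mulmxA mul_diag_mx !mxE /pairing /w !mxE; congr (_ * _).
  by apply: eq_bigr => m _; rewrite [row r P 0 m]mxE.
move=> t tab r; rewrite !QE.
have -> : C i0 = 1 by rewrite /C di0 expr1 divff.
have /eqP := on_curve r t tab; rewrite subr_eq0 => /eqP ->.
by rewrite invr1 mul1r mulKf.
Qed.

(** The parameter of the monomial curve is a continuous function y of the parameter
    of gamma, so it runs over a segment; and exponents that are injective with
    values in 1, .., n form a permutation of them. *)
Lemma self_affine_moment (E : set 'cV[R]_n.+1) :
  nontrivial_self_affine E -> E `<=` gamma @` `[a, b] ->
  exists (c d : R) (f : 'cV[R]_n.+1 -> 'cV[R]_n.+1),
    [/\ c < d, invertible_affine_map f &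
      gamma @` `[a, b] = f @` (moment_curve n.+1 @` `[c, d])].
Proof.
move=> [[E0 cE [l [F [FI EF]]]] nE] EK.
have mv p : exists2 g, selfmap E g & g p != p.
  have [i ip] := not_all_fix p E0 cE FI EF nE; exists (F i) => //.
  have [Fc Fi] := FI i; split=> // x Ex; by rewrite EF; exists i.
have [p [Q [d [i0 [Qu dinj dpos di0 QE]]]]] :=
  monomial_coordinates E0 cE mv EK.
pose y t : R := (Q *m (gamma t - p)) i0 0.
have gammaE t : t \in `[a, b] -> Q *m (gamma t - p) = monomial_curve d (y t).
  by move=> tab; apply/colP => i; rewrite [RHS]mxE QE.
have EE x : E x -> Q *m (x - p) = monomial_curve d ((Q *m (x - p)) i0 0).
  by move=> /EK [t tab <-]; exact: gammaE.
have dle j : (d j <= n.+1)%N.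
  have [g [gc gi gE] gp] := mv p.
  have [T [v [Tu gT]]] := affine_linear_part gi.
  have [g1 sg1 _] := mv p; have [g1c g1i g1E] := sg1.
  have [p1 Ep1 gp1] := selfmap_fixed E0 cE sg1.
  have [h [_ _ hE] hp1] := mv p1.
  pose x k := iter k g1 (h p1).
  have Ex k : E (x k) by elim: k => [|k ih]; [exact: hE|exact: g1E].
  have xinj : injective x := orbit_injective g1c (bij_inj g1i.2) gp1 hp1.
  pose s k : R := (Q *m (x k - p)) i0 0.
  have sinj : injective s.
    move=> k m skm; apply: xinj; apply: (addIr (- p)).
    by apply: (can_inj (mulKmx Qu)); rewrite (EE _ (Ex k)) (EE _ (Ex m)) -/(s k) -/(s m) skm.
  have A_unit : Q *m T *m invmx Q \in unitmx by rewrite !unitmx_mul Qu Tu unitmx_inv.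
  have v_neq0 : Q *m (g p - p) != 0.
    by apply: contraNneq gp => h0; rewrite -subr_eq0 -(mulKmx Qu (g p - p)) h0 mulmx0.
  apply: (exponents_consecutive (i0 := i0) dinj dpos A_unit v_neq0 sinj) => k i.
  have -> : Q *m T *m invmx Q *m monomial_curve d (s k) + Q *m (g p - p) =
      Q *m (g (x k) - p).
    rewrite -(EE _ (Ex k)) -mulmxA mulKmx // -mulmxA -mulmxDr; congr (_ *m _).
    by rewrite mulmxBr !gT !addrA subrK.
  have Egx : E (g (x k)) by exact: gE.
  by have /colP /(_ i) := EE _ Egx; rewrite [in X in _ = X]mxE.
have yc : continuous y.
  move=> t; rewrite (_ : y = fun t => pairing (row i0 Q) (gamma t - p)); last first.
    by apply/funext => r; rewrite /y /pairing -row_mul [RHS]mxE.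
  apply: (cvg_comp (fun t => gamma t - p) (pairing (row i0 Q))); last exact: pairing_continuous.
  by apply: cvgB; [exact: cgamma|exact: cvg_cst].
have [c [e [ce yce]]] := continuous_image_itv (ltW ab) yc.
have clte : c < e.
  rewrite lt_neqAle ce andbT; apply/eqP => ceq.
  have row0 : row i0 Q != 0 := row_unit_neq0 i0 Qu.
  apply: (gamma_spans (c := c + pairing (row i0 Q) p) row0) => t tab.
  have : [set` `[c, e]] (y t) by rewrite -yce; exists t.
  rewrite /= in_itv /= -ceq => /andP[h1 h2].
  have <- : y t = c by apply/eqP; rewrite eq_le h1 h2.
  by rewrite /y /pairing -!row_mul mulmxBr !mxE subrK.
have dlt i : ((d i).-1 < n.+1)%N by rewrite prednK.
pose pi i := Ordinal (dlt i).
have pi_inj : injective pi.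
  move=> i j /(congr1 val) /= e1; apply: dinj.
  by rewrite -(prednK (dpos i)) e1 prednK.
exists c, e, (fun x => invmx Q *m perm_mx (perm pi_inj) *m x + p); split=> //.
  apply: (@affine_invertible _ _ _ (invmx Q *m perm_mx (perm pi_inj)) p) => //.
  by rewrite unitmx_mul unitmx_inv Qu unitmx_perm.
have fE t : t \in `[a, b] ->
    gamma t = invmx Q *m perm_mx (perm pi_inj) *m moment_curve n.+1 (y t) + p.
  move=> tab; rewrite -mulmxA -row_permE.
  rewrite (_ : row_perm _ _ = monomial_curve d (y t)); last first.
    by apply/colP => i; rewrite !mxE permE /= prednK.
  by rewrite -gammaE // mulKmx // subrK.
apply/seteqP; split=> [_ [t tab <-]|_ [_ [r rce <-] <-]].
  exists (moment_curve n.+1 (y t)); last by rewrite fE.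
  by exists (y t) => //; rewrite -yce; exists t.
have [t tab <-] : (y @` `[a, b]) r by rewrite yce.
by exists t => //; rewrite fE.
Qed.

End Curve.

(** * Arcs of the moment curve are self-affine *)

(** Linear part of the affine map induced on the moment curve by the substitution
    t -> r t + s, read off the binomial formula. *)
Definition moment_matrix {R : realType} (n : nat) (r s : R) : 'M[R]_n :=
  \matrix_(i, j) ('C(i.+1, j.+1)%:R * r ^+ j.+1 * s ^+ (i - j)).

Lemma moment_curve_affine {R : realType} n (r s t : R) :
  moment_curve n (r * t + s) =
  moment_matrix n r s *m moment_curve n t + moment_curve n s.
Proof.
apply/colP => i; rewrite !mxE [r * t + s]addrC exprDn big_ord_recl /= subn0 expr0 mulr1 bin0 mulr1n.
rewrite [LHS]addrC.
congr (_ + _); rewrite (big_ord_widen n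
  (fun j => s ^+ (i.+1 - bump 0 j) * (r * t) ^+ bump 0 j *+ 'C(i.+1, bump 0 j))) //.
rewrite big_mkcond /=; apply: eq_bigr => j _; rewrite !mxE /bump /= add1n.
rewrite ltnS; case: leqP => ij; last by rewrite bin_small ?mul0r.
by rewrite subSS exprMn -mulr_natl; ring.
Qed.

Lemma moment_matrix_unit {R : realType} n (r s : R) :
  r != 0 -> moment_matrix n r s \in unitmx.
Proof.
move=> r0; rewrite unitmxE det_trig; last first.
  by apply/is_trig_mxP => i j ij; rewrite mxE bin_small ?mul0r.
rewrite unitfE; apply/prodf_neq0 => i _.
by rewrite mxE binn subnn mulr1 mul1r expf_neq0.
Qed.

Lemma mulmx_bound {R : realType} m n p (A : 'M[R]_(m, n)) (B : 'M[R]_(n, p)) (x y : R) :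
  (forall i j, `|A i j| <= x) -> (forall i j, `|B i j| <= y) ->
  forall i j, `|(A *m B) i j| <= n%:R * (x * y).
Proof.
move=> Ax By i j; rewrite mxE; apply: le_trans (ler_norm_sum _ _ _) _.
rewrite mulr_natl -[X in _ *+ X]card_ord -sumr_const; apply: ler_sum => k _.
by rewrite normrM ler_pM.
Qed.

Lemma entries_bounded {R : realType} m n (A : 'M[R]_(m, n)) :
  exists2 x : R, 0 <= x & forall i j, `|A i j| <= x.
Proof.
exists (\sum_i \sum_j `|A i j|).
  by apply: sumr_ge0 => i _; apply: sumr_ge0.
move=> i j; rewrite (bigD1 i) //= (bigD1 j) //= -addrA lerDl addr_ge0 //.
  by apply: sumr_ge0.
by apply: sumr_ge0 => k _; apply: sumr_ge0.
Qed.

Lemma enorm_le {R : realType} n (y : 'cV[R]_n.+1) (c : R) :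
  (forall i, `|y i 0| <= c) -> enorm y <= n.+1%:R * c.
Proof.
move=> yc; have c0 : 0 <= c := le_trans (normr_ge0 _) (yc 0).
have nc0 : 0 <= n.+1%:R * c by rewrite mulr_ge0.
rewrite /enorm -(ger0_norm nc0) -sqrtr_sqr ler_wsqrtr // exprMn.
apply: (@le_trans _ _ (\sum_(i < n.+1) c ^+ 2)).
  by apply: ler_sum => i _; rewrite -real_normK ?num_real // lerXn2r // nnegrE.
rewrite sumr_const card_ord -[leLHS]mulr_natl ler_wpM2r ?sqr_ge0 //.
by rewrite -natrX ler_nat -mulnn leq_pmulr.
Qed.

Lemma small_matrix_contracts {R : realType} n (A : 'M[R]_n.+1) x :
  (forall i j, `|A i j| <= x) -> n.+1%:R ^+ 2 * x < 1 ->
  forall y, y != 0 -> enorm (A *m y) < enorm y.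
Proof.
move=> Ax nx y y0.
have yb i j : `|y i j| <= enorm y by rewrite ord1; exact: coord_le_enorm.
have h := enorm_le (fun i => mulmx_bound Ax yb i 0).
apply: le_lt_trans h _.
have ey : 0 < enorm y.
  rewrite lt_neqAle enorm_ge0 andbT eq_sym; apply: contraNneq y0.
  by move=> /enorm_eq0 ->.
have -> : n.+1%:R * (n.+1%:R * (x * enorm y)) = n.+1%:R ^+ 2 * x * enorm y by ring.
by rewrite gtr_pMl.
Qed.

(** Every entry contains at least one factor r. *)
Lemma moment_matrix_bound {R : realType} n (B : R) : 0 <= B ->
  exists2 K : R, 0 <= K & forall r s : R, 0 <= r <= 1 -> `|s| <= B ->
    forall i j, `|moment_matrix n r s i j| <= r * K.
Proof.
move=> B0; pose K : R := \sum_(i < n) \sum_(j < n) 'C(i.+1, j.+1)%:R * (1 + B) ^+ (i - j).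
have t0 (i j : 'I_n) : 0 <= 'C(i.+1, j.+1)%:R * (1 + B) ^+ (i - j).
  by rewrite mulr_ge0 // exprn_ge0 // addr_ge0.
exists K; first by apply: sumr_ge0 => i _; apply: sumr_ge0.
move=> r s /andP[r0 r1] sB i j; rewrite mxE !normrM normr_nat !normrX (ger0_norm r0).
rewrite mulrAC [leRHS]mulrC exprSr mulrA; apply: ler_wpM2r => //.
apply: (@le_trans _ _ ('C(i.+1, j.+1)%:R * (1 + B) ^+ (i - j))).
  apply: (@le_trans _ _ ('C(i.+1, j.+1)%:R * `|s| ^+ (i - j))).
    by rewrite ler_piMr ?mulr_ge0 ?exprn_ge0 // exprn_ile1.
  by rewrite ler_wpM2l // lerXn2r ?nnegrE //; lra.
rewrite /K (bigD1 i) //= (bigD1 j) //= -addrA lerDl addr_ge0 //.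
  by apply: sumr_ge0.
by apply: sumr_ge0 => k _; apply: sumr_ge0.
Qed.

Lemma split_segment {R : realType} (c e t : R) m : c < e -> t \in `[c, e] ->
  exists (k : 'I_m.+1) u, u \in `[c, e] /\
    t = m.+1%:R^-1 * u + (c * (1 - m.+1%:R^-1) + (e - c) * (k%:R * m.+1%:R^-1)).
Proof.
rewrite in_itv /= => ce /andP[ct te]; set r := m.+1%:R^-1.
have mr : m.+1%:R * r = 1 by rewrite divff // pnatr_eq0.
have r0 : 0 < r by rewrite invr_gt0 ltr0n.
pose P k := (k <= m)%N && (c + (e - c) * (k%:R * r) <= t).
have P0 : exists k, P k by exists 0%N; rewrite /P leq0n mul0r mulr0 addr0.
have Pm k : P k -> (k <= m)%N by case/andP.
have [k /andP[km kt] kmax] := ex_maxnP P0 Pm.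
have tk : t <= c + (e - c) * (k.+1%:R * r).
  have [km'|mk] := ltnP k m.
    rewrite leNgt; apply/negP => /ltW h.
    by have := kmax k.+1; rewrite /P km' h ltnn => /(_ isT).
  have -> : k = m by apply/eqP; rewrite eqn_leq km mk.
  by rewrite mr; lra.
have km1 : (k < m.+1)%N by [].
exists (Ordinal km1), ((t - (c * (1 - r) + (e - c) * (k%:R * r))) * m.+1%:R).
split; last by rewrite mulrCA [r * _]mulrC mr mulr1 subrK.
rewrite in_itv /=; apply/andP; split.
  by rewrite -ler_pdivrMr ?ltr0n // -/r; lra.
rewrite -ler_pdivlMr ?ltr0n // -/r; move: tk; rewrite -natr1; lra.
Qed.

Lemma join_segment {R : realType} (c e u : R) m (k : 'I_m.+1) :
  c < e -> u \in `[c, e] ->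
  m.+1%:R^-1 * u + (c * (1 - m.+1%:R^-1) + (e - c) * (k%:R * m.+1%:R^-1)) \in `[c, e].
Proof.
rewrite !in_itv /= => ce /andP[cu ue]; set r := m.+1%:R^-1.
have mr : m.+1%:R * r = 1 by rewrite divff // pnatr_eq0.
have r0 : 0 < r by rewrite invr_gt0 ltr0n.
have k0 : 0 <= k%:R :> R by [].
have km : k%:R + 1 <= m.+1%:R :> R by rewrite natr1 ler_nat.
have h1 : r * c <= r * u by rewrite ler_wpM2l // ltW.
have h2 : r * u <= r * e by rewrite ler_wpM2l // ltW.
have h3 : 0 <= (e - c) * (k%:R * r) by rewrite mulr_ge0 ?mulr_ge0 //; lra.
have h4 : (e - c) * ((k%:R + 1) * r) <= (e - c) * (m.+1%:R * r).
  by apply: ler_wpM2l; [lra|apply: ler_wpM2r => //; exact: ltW].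
rewrite mr in h4.
by apply/andP; split; lra.
Qed.

(** The maps F_k are the conjugates by f of the affine maps induced by the m + 1
    affine bijections of [c, e] onto the segments of its regular subdivision. With
    ratio r = 1 / (m + 1), their linear parts are O(r), uniformly in k. *)
Lemma moment_arc_self_affine {R : realType} n (c e : R) (f : 'cV[R]_n.+1 -> 'cV[R]_n.+1) :
  c < e -> invertible_affine_map f ->
  compact (f @` (moment_curve n.+1 @` `[c, e])) ->
  nontrivial_self_affine (f @` (moment_curve n.+1 @` `[c, e])).
Proof.
move=> ce fi cK; have [B [p [Bu fE]]] := affine_linear_part fi.
set E := (X in nontrivial_self_affine X).
have c_ce : c \in `[c, e] by rewrite in_itv /= lexx ltW.
have e_ce : e \in `[c, e] by rewrite in_itv /= lexx ltW.
have Ef t : t \in `[c, e] -> E (f (moment_curve n.+1 t)).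
  by move=> tce; exists (moment_curve n.+1 t) => //; exists t.
split; last first.
  move=> [x Ex].
  have : f (moment_curve n.+1 c) = f (moment_curve n.+1 e).
    by have := Ef _ c_ce; have := Ef _ e_ce; rewrite Ex /= => -> ->.
  move=> /(bij_inj fi.2) /colP /(_ 0); rewrite !mxE !expr1 => ee.
  by rewrite ee ltxx in ce.
split=> //; first by exists (f (moment_curve n.+1 c)); exact: Ef.
have [x1 x10 Bx] := entries_bounded B.
have [x2 x20 Bx2] := entries_bounded (invmx B).
have S0 : 0 <= `|c| + `|e - c| by rewrite addr_ge0.
have [K K0 MK] := moment_matrix_bound n.+1 S0.
pose K3 := n.+1%:R ^+ 2 * (n.+1%:R * (n.+1%:R * (x1 * K) * x2)).
have K30 : 0 <= K3 by rewrite !(mulr_ge0, exprn_ge0).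
pose m := Num.bound K3.
have K3m : K3 < m.+1%:R.
  by apply: lt_le_trans (archi_boundP K30) _; rewrite ler_nat.
pose r : R := m.+1%:R^-1; have r0 : 0 < r by rewrite invr_gt0 ltr0n.
have r1 : r <= 1 by rewrite invf_le1 ?ltr0n // ler1n.
have mr : m.+1%:R * r = 1 by rewrite divff // pnatr_eq0.
pose s (k : 'I_m.+1) : R := c * (1 - r) + (e - c) * (k%:R * r).
have sB k : `|s k| <= `|c| + `|e - c|.
  apply: le_trans (ler_normD _ _) _; rewrite (normrM c) (normrM (e - c)).
  have k0 : 0 <= k%:R * r by rewrite mulr_ge0 // ltW.
  have k1 : k%:R * r <= 1 by rewrite -[leRHS]mr ler_wpM2r ?(ltW r0) // ler_nat ltnW.
  have r10 : 0 <= 1 - r by rewrite subr_ge0.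
  by apply: lerD; rewrite ler_piMr ?normr_ge0 // ger0_norm // lerBlDr lerDl ltW.
pose N k := B *m moment_matrix n.+1 r (s k) *m invmx B.
pose F k x := N k *m x + (p - N k *m p + B *m moment_curve n.+1 (s k)).
have Ff k t : F k (f (moment_curve n.+1 t)) = f (moment_curve n.+1 (r * t + s k)).
  rewrite /F !fE moment_curve_affine !mulmxDr.
  have -> : N k *m (B *m moment_curve n.+1 t) =
      B *m (moment_matrix n.+1 r (s k) *m moment_curve n.+1 t).
    by rewrite /N -!mulmxA (mulmxA _ B) mulVmx // mul1mx.
  rewrite -!addrA; congr (_ + _).
  by rewrite addrCA [_ + (- _ + _)]addrA subrr add0r addrC.
exists m.+1, F; split.
  move=> k; split=> [x y xy|].
    have -> : F k x - F k y = N k *m (x - y).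
      by rewrite /F opprD addrACA subrr addr0 mulmxBr.
    apply: (small_matrix_contracts (x := n.+1%:R * (n.+1%:R * (x1 * (r * K)) * x2))).
    - apply: mulmx_bound => //; apply: mulmx_bound => //; apply: MK => //.
      by rewrite (ltW r0).
    - have -> : n.+1%:R ^+ 2 * (n.+1%:R * (n.+1%:R * (x1 * (r * K)) * x2)) = K3 * r.
        by rewrite /K3; ring.
      by rewrite -[ltRHS]mr ltr_pM2r.
    - by rewrite subr_eq0.
  apply: (affine_invertible (T := N k)) => //.
  by rewrite !unitmx_mul Bu unitmx_inv Bu moment_matrix_unit // gt_eqF.
apply/seteqP; split=> [_ [_ [t tce <-] <-]|_ [k _ [_ [_ [t tce <-] <-] <-]]].
  have [k [u [uce ->]]] := split_segment m ce tce.
  exists k => //; exists (f (moment_curve n.+1 u)); first exact: Ef.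
  by rewrite Ff.
by rewrite Ff; apply: Ef; exact: join_segment.
Qed.

(** * The characterization *)

(** Composition with this retraction onto [a, b] makes a curve continuous on the
    whole line without changing its image. *)
Definition clamp {R : realType} (a b t : R) : R := Num.max a (Num.min t b).

Lemma clamp_itv {R : realType} (a b t : R) : a <= b -> clamp a b t \in `[a, b].
Proof.
by move=> ab; rewrite in_itv /= /clamp le_max lexx /= ge_max ab ge_min lexx orbT.
Qed.

Lemma clamp_id {R : realType} (a b t : R) : t \in `[a, b] -> clamp a b t = t.
Proof. by rewrite in_itv /= => /andP[a_t tb]; rewrite /clamp min_l // max_r. Qed.

Lemma clamp_continuous {R : realType} (a b : R) : continuous (clamp a b).
Proof.
move=> t; apply: (@continuous_max _ _ (fun=> a) (fun s => Num.min s b)).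
  exact: cvg_cst.
by apply: (@continuous_min _ _ (fun s => s) (fun=> b)); [exact: cvg_id|exact: cvg_cst].
Qed.

Lemma clamp_comp_continuous {R : realType} {X : topologicalType} (a b : R) (f : R -> X) :
  a <= b -> {within `[a, b], continuous f} -> continuous (f \o clamp a b).
Proof.
move=> ab /subspace_continuousP fc t.
have tab : [set` `[a, b]] (clamp a b t) by exact: clamp_itv.
apply: (cvg_comp (clamp a b) f _ (fc _ tab)) => P hP.
have {}hP : \forall s \near clamp a b t, s \in `[a, b] -> P s by exact: hP.
have h : \forall s \near t, clamp a b s \in `[a, b] -> P (clamp a b s).
  exact: (@clamp_continuous R a b t _ hP).
suff : \forall s \near t, P (clamp a b s) by [].
by apply: filterS h => s; apply; exact: clamp_itv.
Qed.

Lemma analytic_near_eq {R : realType} (g h : R -> R) t :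
  (\forall s \near t, g s = h s) -> real_analytic_at g t -> real_analytic_at h t.
Proof.
by move=> gh [c gc]; exists c; apply: filterS2 gh gc => s ->.
Qed.

Theorem theorem1 (R : realType) (n : nat) (hn : (2 <= n)%N)
    (a b : R) (hab : a < b) (gamma : R -> 'cV[R]_n)
    (hgamma : analytic_curve a b gamma)
    (hplane : ~ (exists H : set 'cV[R]_n,
        hyperplane H /\ gamma @` `[a, b] `<=` H)) :
  (exists E : set 'cV[R]_n,
      nontrivial_self_affine E /\ E `<=` gamma @` `[a, b]) <->
  (exists (c d : R) (f : 'cV[R]_n -> 'cV[R]_n),
      [/\ c < d, invertible_affine_map f &
          gamma @` `[a, b] = f @` (moment_curve n @` `[c, d])]).
Proof.
case: n hn gamma hgamma hplane => [//|n] _ gamma [[_ gc _] ga] hplane.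
pose delta := gamma \o clamp a b.
have dg t : t \in `[a, b] -> delta t = gamma t by move=> tab; rewrite /delta /= clamp_id.
have img : delta @` `[a, b] = gamma @` `[a, b].
  by apply/seteqP; split=> [_ [t tab <-]|_ [t tab <-]]; exists t; rewrite ?dg.
have dc : continuous delta by exact: clamp_comp_continuous (ltW hab) gc.
split=> [[E [nE EK]]|[c [d [f [cd fi K]]]]].
  rewrite -img; apply: (self_affine_moment hab dc _ _ nE); last by rewrite img.
    move=> i t tab; apply: analytic_near_eq ((ga i).2 t tab).
    have tab' : a < t < b by rewrite in_itv in tab.
    near=> s; rewrite dg // in_itv /=.
    have : s \in `]a, b[ by near: s; exact: near_in_itvoo.
    by rewrite in_itv /= => /andP[/ltW -> /ltW ->].
  move=> u c u0 cst; apply: hplane.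
  exists [set x | \sum_(i < n.+1) u^T i 0 * x i 0 = c]; split.
    by exists u^T, c; split=> //; apply: contraNneq u0 => uT; rewrite -(trmxK u) uT trmx0.
  move=> _ [t tab <-] /=; rewrite -(cst t tab) dg // pairingE.
  by apply: eq_bigr => i _; rewrite mxE.
exists (gamma @` `[a, b]); split=> //; rewrite K.
apply: moment_arc_self_affine => //; rewrite -K.
exact: continuous_compact gc (@segment_compact _ a b).
Unshelve. all: by end_near. Qed.
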